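(* Let $s \in (1,2]$. The set of functions $f \in C[0,1]$ whose graph satisfies $$\dim_{\mathcal{H}}(f) = \dim_{B}(f) = s$$ is strongly $\mathfrak{c}$-algebrable.
   Context: $C[0,1]$ is the algebra (with pointwise operations) of continuous functions $f:[0,1]\to\mathbb{R}$. A function is identified with its graph: $\dim_{\mathcal H}(f)$ and $\dim_B(f)$ denote the Hausdorff dimension and the box dimension of $\{(x,f(x)) : x\in[0,1]\}\subseteq\mathbb{R}^2$. For a bounded set $E\subseteq\mathbb{R}^d$, $N_\delta(E)$ is the minimal number of cubes of size $\delta$ needed to cover $E$, and $\dim_B(E)=\lim_{\delta\to0^+}\frac{\log N_\delta(E)}{-\log\delta}$ when this limit exists (so $\dim_B(f)=s$ includes the existence of the limit). $\mathfrak{c}$ is the cardinality of $\mathbb{R}$. Strong algebrability: for a commutative algebra $\mathcal{A}$ and a cardinal $\kappa$, a subset $\mathcal{B}\subseteq\mathcal{A}$ is strongly $\kappa$-algebrable if there is a $\kappa$-generated free algebra contained in $\mathcal{B}\cup\{0\}$, i.e. there is a set $X\subseteq\mathcal{A}$ of cardinality $\kappa$ such that (1) the subalgebra generated by $X$ (all $P(x_1,\dots,x_n)$ with $x_1,\dots,x_n\in X$ and $P$ a real polynomial without constant term) is contained in $\mathcal{B}\cup\{0\}$, and (2) $X$ is free: for every polynomial $P$ without constant term and any distinct $x_1,\dots,x_n\in X$, $P(x_1,\dots,x_n)=0$ if and only if $P=0$. *)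

(* Defs.v *)
From HB Require Import structures.
From mathcomp Require Import all_boot all_order all_algebra.
From mathcomp Require Import all_classical all_reals all_analysis.
(* The notations of mpoly clash with those of mathcomp-analysis. *)
From mathcomp Require mpoly.
Import (canonicals) mpoly.
Import Order.TTheory GRing.Theory Num.Theory.
Import numFieldNormedType.Exports.

Set Implicit Arguments.
Unset Strict Implicit.
Unset Printing Implicit Defensive.

Local Open Scope classical_set_scope.
Local Open Scope ring_scope.

(* Cardinals are represented by sets: [kappa] stands for its cardinality. *)
Section algebrability.
Context {K : fieldType} {A : comAlgType K}.

Definition no_constant_term n (P : mpoly.mpoly n K) : Prop :=
  mpoly.mcoeff mpoly.mnm0 P = 0.

Definition mpoly_eval n (x : 'I_n -> A) (P : mpoly.mpoly n K) : A :=
  mpoly.mmap (in_alg A) x P.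

(* The subalgebra is not required to contain 1. *)
Definition generated_subalgebra (X : set A) : set A :=
  [set a | exists n (x : 'I_n -> A) (P : mpoly.mpoly n K),
    [/\ forall i, X (x i), no_constant_term P & a = mpoly_eval x P]].

Definition free_generators (X : set A) : Prop :=
  forall n (x : 'I_n -> A) (P : mpoly.mpoly n K),
    injective x -> (forall i, X (x i)) -> no_constant_term P ->
    mpoly_eval x P = 0 <-> P = 0.

Definition strongly_algebrable {T : Type} (kappa : set T) (B : set A) : Prop :=
  exists X : set A, [/\ (X #= kappa)%card,
    generated_subalgebra X `<=` B `|` [set 0] & free_generators X].

End algebrability.

Section pointwise_continuity.
Context {R : realType} {T : topologicalType}.
Implicit Types f g : continuousType T R.

Lemma continuous_pointwise_add f g : continuous (fun x => f x + g x).
Proof. by move=> x; apply: cvgD; exact: cts_fun. Qed.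

Lemma continuous_pointwise_opp f : continuous (fun x => - f x).
Proof. by move=> x; apply: cvgN; exact: cts_fun. Qed.

Lemma continuous_pointwise_mul f g : continuous (fun x => f x * g x).
Proof. by move=> x; apply: cvgM; exact: cts_fun. Qed.

End pointwise_continuity.

Section continuous_functions.
Context {R : realType}.

Definition unit_interval : topologicalType := set_type (`[0, 1]%classic : set R).

Definition C01 : Type := continuousType unit_interval R.
HB.instance Definition _ := Choice.on C01.

Lemma C01P (f g : C01) : (forall x, f x = g x) -> f = g.
Proof. by move=> fg; apply/continuousEP => x; exact: fg. Qed.

Definition C01_mk (f : unit_interval -> R) (fc : continuous f) : C01 :=
  mkcts fc.

Definition C01_cst (c : R) : C01 := cst c.
Definition C01_add (f g : C01) : C01 := C01_mk (@continuous_pointwise_add _ _ f g).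
Definition C01_opp (f : C01) : C01 := C01_mk (@continuous_pointwise_opp _ _ f).
Definition C01_mul (f g : C01) : C01 := C01_mk (@continuous_pointwise_mul _ _ f g).
Definition C01_scale (c : R) (f : C01) : C01 := C01_mul (C01_cst c) f.

Lemma C01_addA : associative C01_add.
Proof. by move=> f g h; apply: C01P => x; exact: addrA. Qed.
Lemma C01_addC : commutative C01_add.
Proof. by move=> f g; apply: C01P => x; exact: addrC. Qed.
Lemma C01_add0 : left_id (C01_cst 0) C01_add.
Proof. by move=> f; apply: C01P => x; exact: add0r. Qed.
Lemma C01_addN : left_inverse (C01_cst 0) C01_opp C01_add.
Proof. by move=> f; apply: C01P => x; exact: addNr. Qed.

HB.instance Definition _ :=
  GRing.isZmodule.Build C01 C01_addA C01_addC C01_add0 C01_addN.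

Lemma C01_mulA : associative C01_mul.
Proof. by move=> f g h; apply: C01P => x; exact: mulrA. Qed.
Lemma C01_mulC : commutative C01_mul.
Proof. by move=> f g; apply: C01P => x; exact: mulrC. Qed.
Lemma C01_mul1 : left_id (C01_cst 1) C01_mul.
Proof. by move=> f; apply: C01P => x; exact: mul1r. Qed.
Lemma C01_mulD : left_distributive C01_mul +%R.
Proof. by move=> f g h; apply: C01P => x; exact: mulrDl. Qed.
Lemma C01_one_neq0 : C01_cst 1 != 0.
Proof.
have I0 : (0 : R) \in `[0, 1]%classic.
  by rewrite inE /= in_itv /= lexx ler01.
apply/eqP => /(congr1 (fun f : C01 => f (exist _ 0 I0))) /= /eqP.
by apply/negP; exact: oner_neq0.
Qed.

HB.instance Definition _ := GRing.Zmodule_isComNzRing.Build C01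
  C01_mulA C01_mulC C01_mul1 C01_mulD C01_one_neq0.

Lemma C01_scaleA (a b : R) (f : C01) :
  C01_scale a (C01_scale b f) = C01_scale (a * b) f.
Proof. by apply: C01P => x; exact: mulrA. Qed.
Lemma C01_scale1 : left_id 1 C01_scale.
Proof. by move=> f; apply: C01P => x; exact: mul1r. Qed.
Lemma C01_scaleDr : right_distributive C01_scale +%R.
Proof. by move=> a f g; apply: C01P => x; exact: mulrDr. Qed.
Lemma C01_scaleDl (f : C01) : {morph C01_scale^~ f : a b / a + b}.
Proof. by move=> a b; apply: C01P => x; exact: mulrDl. Qed.

HB.instance Definition _ := GRing.Zmodule_isLmodule.Build R C01
  C01_scaleA C01_scale1 C01_scaleDr C01_scaleDl.

Lemma C01_scaleAl (a : R) (f g : C01) : a *: (f * g) = (a *: f) * g.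
Proof. by apply: C01P => x; exact: mulrA. Qed.

HB.instance Definition _ := GRing.Lmodule_isLalgebra.Build R C01 C01_scaleAl.

Lemma C01_scaleAr (a : R) (f g : C01) : a *: (f * g) = f * (a *: g).
Proof. by rewrite mulrC C01_scaleAl mulrC. Qed.

HB.instance Definition _ :=
  GRing.LSemiAlgebra_isSemiAlgebra.Build R C01 C01_scaleAr.

Definition graph (f : C01) : set 'rV[R]_2 :=
  [set p | exists x : unit_interval, p 0 0 = val x /\ p 0 1 = f x].

End continuous_functions.
Arguments unit_interval : clear implicits.
Arguments C01 : clear implicits.

Section dimensions.
Context {R : realType} {d : nat}.
Implicit Types (E U : set 'rV[R]_d) (delta s : R).

(* The library norm on ['rV[R]_d] is the sup norm. *)
Definition euclidean_dist (x y : 'rV[R]_d) : R :=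
  Num.sqrt (\sum_(i < d) (x 0 i - y 0 i) ^+ 2).

Definition diam U : \bar R :=
  ereal_sup [set (euclidean_dist p.1 p.2)%:E | p in U `*` U].

(* [diam set0 = -oo], so the empty set is treated apart; as [0 `^ 0 = 1],
   a nonempty set has weight 1 when [s = 0]. *)
Definition diam_pow s U : \bar R :=
  if U == set0 then 0%E else poweR (diam U) s.

Definition hausdorff_premeasure s delta E : \bar R :=
  ereal_inf [set (\sum_(0 <= k <oo) diam_pow s (U k))%E |
    U in [set U : (set 'rV[R]_d)^nat |
      E `<=` \bigcup_k U k /\ forall k, (diam (U k) <= delta%:E)%E]].

Definition hausdorff_measure s E : \bar R :=
  ereal_sup [set hausdorff_premeasure s delta E |
    delta in [set delta | 0 < delta]].

Definition hausdorff_dim E : \bar R :=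
  ereal_inf [set s%:E | s in [set s | 0 <= s /\ hausdorff_measure s E = 0%E]].

Definition cube (a : 'rV[R]_d) delta : set 'rV[R]_d :=
  [set x | forall i, a 0 i <= x 0 i <= a 0 i + delta].

Definition covered_by_cubes delta E : set nat :=
  [set n | exists a : 'I_n -> 'rV[R]_d, E `<=` \bigcup_i cube (a i) delta].

(* The least element of [covered_by_cubes delta E], which is nonempty for
   [E] bounded and [0 < delta]. *)
Definition covering_number delta E : nat :=
  xget 0%N [set n | covered_by_cubes delta E n /\
    forall m, covered_by_cubes delta E m -> (n <= m)%N].

Definition has_box_dim E s : Prop :=
  ln (covering_number delta E)%:R / - ln delta @[delta --> 0^'+] --> s.

End dimensions.

(* Main.v *)
(** Let [f] be a zigzag function: at stage [n], every monotone piece of the graph is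
    replaced by [p n] full up-and-down laps, each cut into [q n] equal strips.
    With [P n], [Q n] the products of the [p i] and [q i], [f] oscillates by [1 / Q n]
    on the [P n * Q n] intervals of level [n], and on each of them its values are
    uniformly distributed in a strip of that height.  So a set of diameter [rho] close
    to [1 / (P n * Q n)] sees a Lebesgue measure of order [rho / P n] of abscissae.
    With [P n] close to [3 ^ (th * n ^ 2)] and [P n * Q n] close to [3 ^ (n ^ 2)] this
    is [rho ^ (1 + th)] up to an arbitrarily small loss in the exponent, on every
    subinterval, and the graph over every subinterval has Hausdorff and box dimension
    [1 + th].  Both dimensions survive composition with a Lipschitz [phi] which is
    bi-Lipschitz on some interval of values of [f].

    The generators are [g_r o f] with [g_r y = exp (- exp (r / y))], [r > 0].  The
    monomials in the [g_r] decay at pairwise incomparable rates as [y] goes to [0], so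
    the [g_r] are algebraically independent.  A nonzero polynomial [phi] in them
    vanishes at [0 = f 0] but not identically on [f [0, 1]], so it has a nonzero
    derivative at some value of [f]. *)

Require Import Defs.
From mathcomp Require Import all_boot all_order all_algebra.
From mathcomp Require Import all_classical all_reals all_analysis.
From mathcomp Require Import zify ring lra.
From mathcomp Require mpoly.
Import (coercions, canonicals) mpoly.
Import Order.TTheory GRing.Theory Num.Theory.
Import numFieldNormedType.Exports.

Set Implicit Arguments.
Unset Strict Implicit.
Unset Printing Implicit Defensive.

(** * Zigzag functions *)

Section stripes.
Variables p q : nat -> nat.

(* The graph over the [k]-th cell of level [n] crosses the [stripe n k]-th horizontal
   strip, downwards when [flip n k].  A cell is cut into [p n] laps of [q n] cells; the
   number of laps must be odd for the new path to have the same endpoints. *)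
Fixpoint flip n k : bool :=
  if n is n'.+1 then
    flip n' (k %/ q n' %/ p n') (+) odd ((k %/ q n') %% p n')
  else false.

Fixpoint stripe n k : nat :=
  if n is n'.+1 then
    q n' * stripe n' (k %/ q n' %/ p n') +
    (if flip n k then (q n').-1 - k %% q n' else k %% q n')
  else k.

Hypothesis p_odd : forall n, odd (p n).
Hypothesis q_gt0 : forall n, 0 < q n.

Let p_gt0 n : 0 < p n.
Proof. by have := p_odd n; case: (p n). Qed.

Lemma divn_succ d k : 0 < d ->
  if k %% d == d.-1 then k.+1 %/ d = (k %/ d).+1 /\ k.+1 %% d = 0
  else k.+1 %/ d = k %/ d /\ k.+1 %% d = (k %% d).+1.
Proof.
move=> d0; have := ltn_pmod k d0; have := divn_eq k d.
set a := k %/ d; set r := k %% d => -> rd.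
case: eqP => rE.
  have -> : (a * d + r).+1 = a.+1 * d by rewrite mulSn; lia.
  by rewrite mulnK // modnMl.
by rewrite -addnS divnMDl // divn_small ?modnMDl ?modn_small ?addn0 //; lia.
Qed.

(** Continuity of the path: in units of one strip, the left side is the height at which it leaves
    cell [k], the right side the height at which it enters cell [k.+1]. Between laps it turns
    around; between parent cells induction applies, since the last of an odd number of laps runs in
    the parent's direction. *)
Lemma stripe_succ n k :
  stripe n k + ~~ flip n k = stripe n k.+1 + flip n k.+1.
Proof.
elim: n k => [|n IHn] k /=; first by rewrite addn0 addn1.
have := divn_succ k (q_gt0 n).
have := ltn_pmod k (q_gt0 n); have q0 := q_gt0 n.
case: ifPn => [/eqP kq _ [-> ->]|kq kq' [-> ->]]; last first.
  by case: (_ (+) _) => /=; move: kq; rewrite -[X in _ == X]/(_.-1); lia.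
set u := k %/ q n.
have := divn_succ u (p_gt0 n); have p0 := p_gt0 n; have po := p_odd n.
case: ifPn => [/eqP up [-> ->]|up [-> ->]].
  have ou : odd (u %% p n) = false by rewrite up; move: po p0; lia.
  rewrite ou /= !addbF; have := IHn (u %/ p n).
  by rewrite kq subnn; case: (flip n _); case: (flip n _) => /=; nia.
by rewrite /= addbN; case: (_ (+) _) => /=; rewrite kq; nia.
Qed.

Lemma stripe0 n : (stripe n 0 = 0) * (flip n 0 = false).
Proof. by elim: n => [|n [s0 f0]] //=; rewrite !div0n !mod0n f0 s0 muln0. Qed.

(** This index is one past the last cell over [0, 1]. As level 0 is the identity, the path goes on
    above height 1, so that [zigzag] takes the value 1 at 1. *)
Lemma stripe_prod n :
  (stripe n (\prod_(i < n) (p i * q i)) = \prod_(i < n) q i) *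
  (flip n (\prod_(i < n) (p i * q i)) = false).
Proof.
elim: n => [|n [s1 f1]] /=; first by rewrite !big_ord0.
rewrite !big_ord_recr /= mulnA !mulnK ?p_gt0 // f1 s1.
by rewrite !modnMl /= addn0 mulnC.
Qed.

Lemma stripe_div n k : stripe n.+1 k %/ q n = stripe n (k %/ q n %/ p n).
Proof.
have q0 := q_gt0 n; rewrite [stripe n.+1 k]/= mulnC divnMDl //.
set r := (if _ then _ else _); suff rq : r < q n by rewrite (divn_small rq) addn0.
by rewrite /r; case: ifP => _; [move: (k %% q n) => j; lia | exact: ltn_pmod].
Qed.

Lemma stripe_succ_dist n k : (stripe n k <= (stripe n k.+1).+1) /\
  (stripe n k.+1 <= (stripe n k).+1).
Proof.
by have := stripe_succ n k; case: (flip n k); case: (flip n k.+1) => /=; lia.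
Qed.

(* Within a block of [q n] consecutive cells the stripe determines the cell,
   so only the [p n] choices of the block remain. *)
Lemma stripe_children n e b : exists s : seq nat, size s = p n /\
  forall k, k %/ q n %/ p n = e -> stripe n.+1 k = b -> k \in s.
Proof.
pose r i := if flip n e (+) odd i then (q n).-1 - b %% q n else b %% q n.
exists [seq (e * p n + i) * q n + r i | i <- iota 0 (p n)].
rewrite size_map size_iota; split=> // k ke kb.
apply/mapP; exists ((k %/ q n) %% p n).
  by rewrite mem_iota add0n ltn_pmod.
have q0 := q_gt0 n.
rewrite -ke -divn_eq {1}(divn_eq k (q n)); congr (_ + _).
rewrite /r -kb /= ke mulnC modnMDl.
have := ltn_pmod k q0; move: (k %% q n) => j jq.
by case: (_ (+) _); rewrite [in RHS]modn_small; lia.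
Qed.

End stripes.

Local Open Scope classical_set_scope.
Local Open Scope ring_scope.

Lemma truncn_div (R : realType) (x : R) (d : nat) : (0 < d)%N ->
  (Num.truncn (d%:R * x) %/ d)%N = Num.truncn x.
Proof.
move=> d0; have dR : 0 < d%:R :> R by rewrite ltr0n.
have [x0|x0] := leP 0 x; last first.
  have tr y : y < 0 :> R -> Num.truncn y = 0%N.
    by move=> y0; apply/truncn0Pn; rewrite -ltNge; apply: lt_trans y0 _.
  by rewrite !tr ?div0n // pmulr_rlt0.
have /andP[] := truncn_itv (mulr_ge0 (ltW dR) x0).
set t := Num.truncn _ => tle tgt.
apply/esym/truncn_def/andP; split.
  rewrite -(ler_pM2l dR) (le_trans _ tle)// -natrM ler_nat mulnC.
  exact: leq_divM.
rewrite -(ltr_pM2l dR) (lt_le_trans tgt)// -natrM ler_nat mulnC.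
exact: ltn_ceil.
Qed.

(** * Zigzag functions as limits over nested strips *)

Section zigzag.
Variable R : realType.
Variables p q : nat -> nat.
Hypothesis p_odd : forall n, odd (p n).
Hypothesis q_gt0 : forall n, (0 < q n)%N.

Definition laps n := (\prod_(i < n) p i)%N.
Definition strips n := (\prod_(i < n) q i)%N.
Definition cells n := (\prod_(i < n) (p i * q i))%N.

Definition cell n (x : R) := Num.truncn ((cells n)%:R * x).

(** The strips are nested, so their lower edges increase with [n] and this supremum is their
    limit. *)
Definition zigzag (x : R) : R :=
  sup [set (stripe p q n (cell n x))%:R / (strips n)%:R | n in [set: nat]].

Let p_gt0 n : (0 < p n)%N.
Proof. by have := p_odd n; case: (p n). Qed.

Lemma laps_gt0 n : (0 < laps n)%N.
Proof. by rewrite prodn_gt0. Qed.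

Lemma strips_gt0 n : (0 < strips n)%N.
Proof. by rewrite prodn_gt0. Qed.

Lemma cells_gt0 n : (0 < cells n)%N.
Proof. by apply: prodn_gt0 => i; rewrite muln_gt0 p_gt0 q_gt0. Qed.

Lemma cellsE n : cells n = (laps n * strips n)%N.
Proof. exact: big_split. Qed.

Lemma cellS n x : (cell n.+1 x %/ q n %/ p n)%N = cell n x.
Proof.
rewrite -divnMA mulnC /cell /cells big_ord_recr /= mulnC natrM -mulrA.
by rewrite truncn_div // muln_gt0 p_gt0 q_gt0.
Qed.

Lemma cell_close n x y :
  `|x - y| <= (cells n)%:R^-1 -> (cell n x <= (cell n y).+1)%N.
Proof.
have c0 : 0 < (cells n)%:R :> R by rewrite ltr0n cells_gt0.
move=> xy; rewrite /cell truncn_le_nat.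
have : x - y <= (cells n)%:R^-1 by exact: le_trans (ler_norm _) xy.
rewrite -(ler_pM2l c0) mulfV ?gt_eqF// mulrBr => h.
have := truncnS_gt ((cells n)%:R * y); set t := Num.truncn _.
rewrite -[t.+2%:R]natr1 => h2.
by move: h h2; set u := _ * x; set v := _ * y; lra.
Qed.

Notation st n x := (stripe p q n (cell n x)).

Let strips_gt0R n : 0 < (strips n)%:R :> R.
Proof. by rewrite ltr0n strips_gt0. Qed.

Lemma stripe_cellS n x :
  (st n x * q n <= st n.+1 x)%N /\ ((st n.+1 x).+1 <= (st n x).+1 * q n)%N.
Proof.
have h := stripe_div p q_gt0 n (cell n.+1 x); rewrite cellS in h.
by rewrite -h; split; [exact: leq_divM | exact: ltn_ceil].
Qed.

Lemma stripe_mono n m x : (n <= m)%N ->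
  (st n x)%:R / (strips n)%:R <= (st m x)%:R / (strips m)%:R :> R /\
  (st m x).+1%:R / (strips m)%:R <= (st n x).+1%:R / (strips n)%:R :> R.
Proof.
elim: m => [|m IHm]; first by rewrite leqn0 => /eqP ->.
rewrite leq_eqVlt => /orP[/eqP -> //|nm].
have [l u] := IHm nm; have [h1 h2] := stripe_cellS m x.
have E (a b : nat) : a%:R / (strips m)%:R <= b%:R / (strips m.+1)%:R :> R =
    (a * q m <= b)%N.
  have q0 : 0 < (q m)%:R :> R by rewrite ltr0n.
  rewrite /strips big_ord_recr /= -/(strips m) natrM ler_pdivlMr ?mulr_gt0//.
  by rewrite mulrA divfK ?gt_eqF// -natrM ler_nat.
have E' (a b : nat) : b%:R / (strips m.+1)%:R <= a%:R / (strips m)%:R :> R =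
    (b <= a * q m)%N.
  have q0 : 0 < (q m)%:R :> R by rewrite ltr0n.
  rewrite /strips big_ord_recr /= -/(strips m) natrM ler_pdivrMr ?mulr_gt0//.
  by rewrite mulrA divfK ?gt_eqF// -natrM ler_nat.
by split; [apply: le_trans l _; rewrite E | apply: le_trans u; rewrite E'].
Qed.

Lemma zigzag_itv n x :
  (st n x)%:R / (strips n)%:R <= zigzag x <= (st n x).+1%:R / (strips n)%:R.
Proof.
have ub : ubound [set ((st m x)%:R / (strips m)%:R : R) | m in [set: nat]]
    ((st n x).+1%:R / (strips n)%:R).
  move=> _ [m _ <-].
  (* The strips of levels [m] and [n] are compared through that of level [maxn m n]. *)
  have [l _] := stripe_mono x (leq_maxl m n).
  have [_ u] := stripe_mono x (leq_maxr m n).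
  apply: (le_trans l); apply: le_trans u.
  by rewrite ler_pM2r ?invr_gt0// ler_nat.
apply/andP; split; last by apply: ge_sup => //; exists ((st 0 x)%:R / (strips 0)%:R), 0%N.
by apply: ub_le_sup; [exists ((st n x).+1%:R / (strips n)%:R) | exists n].
Qed.

(** Points at most one cell width apart lie in equal or adjacent cells, hence in equal or adjacent
    strips, which together have two strip heights. *)
Lemma zigzag_close n x y : `|x - y| <= (cells n)%:R^-1 ->
  `|zigzag x - zigzag y| <= 2%:R / (strips n)%:R.
Proof.
move=> xy.
have close u v : `|u - v| <= (cells n)%:R^-1 -> (st n u <= (st n v).+1)%N.
  move=> uv; have := cell_close uv; rewrite distrC in uv.
  have := cell_close uv; move: (cell n u) (cell n v) => i j ij ji.
  have [->|[->|->]] : i = j \/ i = j.+1 \/ j = i.+1 by lia.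
  - exact: leqnSn.
  - exact: (stripe_succ_dist p_odd q_gt0 n j).2.
  - exact: (stripe_succ_dist p_odd q_gt0 n i).1.
have half u v : `|u - v| <= (cells n)%:R^-1 ->
    zigzag u - zigzag v <= 2%:R / (strips n)%:R.
  move=> uv; have /andP[_ h1] := zigzag_itv n u.
  have /andP[h2 _] := zigzag_itv n v.
  suff : (st n u).+1%:R / (strips n)%:R <=
      2%:R / (strips n)%:R + (st n v)%:R / (strips n)%:R :> R.
    by move: h1 h2; move: (_ / _) (_ / _) (_ / _) => ? ? ?; lra.
  by rewrite -mulrDl ler_pM2r ?invr_gt0// -natrD ler_nat ltnS; exact: close.
by rewrite ler_norml half// andbT lerNl opprB half// distrC.
Qed.

Lemma zigzag0 : zigzag 0 = 0.
Proof.
apply/eqP; rewrite eq_le; apply/andP; split.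
  apply: ge_sup; first by exists ((st 0 0)%:R / (strips 0)%:R), 0%N.
  by move=> _ [m _ <-]; rewrite /cell mulr0 truncn0 stripe0 // mul0r.
by have /andP[+ _] := zigzag_itv 0 0; rewrite /cell mulr0 truncn0 stripe0 // mul0r.
Qed.

Lemma zigzag1 : zigzag 1 = 1.
Proof.
rewrite /zigzag (_ : [set _ | _ in _] = [set 1]) ?sup1//.
have E n : (st n 1)%:R / (strips n)%:R = 1 :> R.
  rewrite /cell mulr1 natrK stripe_prod // -/(strips n) mulfV//.
  by rewrite gt_eqF.
by apply/seteqP; split => [_ [m _ <-]|_ ->]; [exact: E | exists 0%N].
Qed.

Lemma zigzag_ge0 x : 0 <= zigzag x.
Proof.
by have /andP[+ _] := zigzag_itv 0 x; apply: le_trans; rewrite divr_ge0.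
Qed.

(** The count behind the uniform distribution of values: the strip [b] fixes the strip at every
    earlier level, and each level leaves [p] choices. The list thus has [laps (n + d) / laps n]
    elements, written without division. *)
Lemma stripe_descendants n d (a b : nat) : exists s : seq nat,
  (size s * laps n = laps (n + d))%N /\
  forall x, cell n x = a -> st (n + d) x = b -> cell (n + d) x \in s.
Proof.
elim: d b => [|d IHd] b.
  exists [:: a]; rewrite addn0 mul1n; split=> // x <- _; exact: mem_head.
have [s [ss sP]] := IHd (b %/ q (n + d))%N.
have [r rP] := choice (fun e => stripe_children p_odd q_gt0 (n + d) e b).
exists (flatten [seq r e | e <- s]); split.
  rewrite size_flatten /shape -map_comp (eq_map (g := fun=> p (n + d))); last first.
    by move=> e; exact: (rP e).1.
  rewrite sumnE big_map big_const_seq count_predT iter_addn_0.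
  have -> : (laps (n + d.+1) = laps (n + d) * p (n + d))%N.
    by rewrite addnS /laps big_ord_recr.
  by rewrite -ss; lia.
move=> x xa xb; rewrite addnS in xb *.
apply/flatten_mapP; exists (cell (n + d) x).
  by apply: sP => //; rewrite -xb stripe_div // cellS.
by apply: (rP _).2; rewrite ?cellS.
Qed.

End zigzag.

(** * Occupation measure of a zigzag function *)

Lemma nneseries_le_const (R : realType) (F : nat -> \bar R) (n : nat) (c : R) :
  (forall k, 0 <= F k)%E -> (forall k, (k < n)%N -> (F k <= c%:E)%E) ->
  (forall k, (n <= k)%N -> F k = 0%E) ->
  (\sum_(0 <= k <oo) F k <= (n%:R * c)%:E)%E.
Proof.
move=> F0 Fc Fn; rewrite (nneseries_split 0 n)// add0n.
rewrite [X in (_ + X)%E]eseries0 ?adde0; last by move=> k nk _; exact: Fn.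
apply: (@le_trans _ _ (\sum_(0 <= k < n) c%:E)%E).
  by rewrite big_nat [leRHS]big_nat; apply: lee_sum => k /andP[_]; exact: Fc.
by rewrite sumEFin big_const_nat subn0 iter_addr_0 mulr_natl.
Qed.

Section outer_lebesgue.
Variable R : realType.

(** Lebesgue measure as an outer measure on all sets: the sets of a cover are arbitrary, and the
    sets of abscissae they define may fail to be measurable. *)
Definition leb : set R -> \bar R := (@lebesgue_measure R).

Lemma leb_sigma_subadditive : sigma_subadditive leb.
Proof. exact: (@mu_ext_sigma_subadditive _ (ocitv_type R) R (wlength idfun)). Qed.

Lemma le_leb (A B : set R) : A `<=` B -> (leb A <= leb B)%E.
Proof. exact: (@le_mu_ext _ (ocitv_type R) R (wlength idfun)). Qed.

Lemma leb_ge0 (A : set R) : (0 <= leb A)%E.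
Proof. exact: (@mu_ext_ge0 _ (ocitv_type R) R (wlength idfun)). Qed.

Lemma leb0 : leb set0 = 0%E.
Proof. exact: measure0. Qed.

Lemma leb_itv (a b : R) : a <= b -> leb `[a, b] = (b - a)%:E.
Proof.
move=> ab; rewrite /leb lebesgue_measure_itv /= lte_fin.
by case: ltgtP ab => // ->; rewrite subrr.
Qed.

Lemma leb_cover_seq (I : eqType) (A : I -> set R) (s : seq I) (c : R) (X : set R) :
  (forall i, i \in s -> (leb (A i) <= c%:E)%E) ->
  (forall x, X x -> exists2 i, i \in s & A i x) ->
  (leb X <= ((size s)%:R * c)%:E)%E.
Proof.
move=> Ac XA.
pose G k := nth set0 [seq A i | i <- s] k.
have XG : X `<=` \bigcup_k G k.
  move=> x /XA[i si Ai]; exists (index i s) => //.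
  by rewrite /G (nth_map i) ?index_mem// nth_index.
apply: (le_trans (le_leb XG)); apply: (le_trans (leb_sigma_subadditive _)).
apply: nneseries_le_const => k; first exact: leb_ge0.
  case: s {XA XG} @G Ac => // i0 s G Ac ks; rewrite /G (nth_map i0)//.
  by apply: Ac; rewrite mem_nth.
by move=> ks; rewrite /G nth_default ?leb0// size_map.
Qed.

End outer_lebesgue.

Section zigzag_occupation.
Variable R : realType.
Variables p q : nat -> nat.
Hypothesis p_odd : forall n, odd (p n).
Hypothesis q_gt1 : forall n, (1 < q n)%N.
Let q_gt0 n : (0 < q n)%N := ltnW (q_gt1 n).
Notation st n x := (stripe p q n (cell p q n x)).

Lemma ltn_strips n : (n < strips q n)%N.
Proof.
elim: n => [|n IHn]; first by rewrite /strips big_ord0.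
rewrite /strips big_ord_recr /= -/(strips _ _).
by have := q_gt1 n; move: IHn; nia.
Qed.

(** Nonnegativity matters because [cell] sends all negative numbers to 0. *)
Lemma leb_cell n k : (leb [set x : R | (0 <= x)%R /\ cell p q n x = k] <=
  ((cells p q n)%:R^-1)%:E)%E.
Proof.
have c0 : 0 < (cells p q n)%:R :> R by rewrite ltr0n (cells_gt0 p_odd q_gt0).
have : [set x : R | 0 <= x /\ cell p q n x = k] `<=`
    `[k%:R / (cells p q n)%:R, k.+1%:R / (cells p q n)%:R].
  move=> x [x0 <-] /=; rewrite in_itv /= ler_pdivrMr// ler_pdivlMr//.
  rewrite [x * _]mulrC.
  have := truncn_itv (mulr_ge0 (ltW c0) x0).
  by move=> /andP[-> /ltW].
move/le_leb/le_trans; apply; rewrite leb_itv ?ler_pM2r ?invr_gt0 ?ler_nat//.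
by rewrite -mulrBl -natrB// subSnn mul1r.
Qed.

(* [X] meets at most three cells of level [n]; inside each of them, at a level [N]
   with [1 / strips N <= rho], a given strip is crossed by [laps N / laps n] cells. *)
Lemma leb_zigzag n (K rho : R) (X : set R) : 0 <= K -> 0 < rho ->
  rho <= (cells p q n)%:R^-1 ->
  (forall x, X x -> 0 <= x) ->
  (forall x y, X x -> X y -> `|x - y| <= rho /\
     `|zigzag p q x - zigzag p q y| <= K * rho) ->
  (leb X <= (3 * (2 * K + 5) * rho / (laps p n)%:R)%:E)%E.
Proof.
move=> K0 rho0 rhon X0 XX.
have [->|/set0P[x0 Xx0]] := eqVneq X set0.
  by rewrite leb0 lee_fin divr_ge0// mulr_ge0 ?(ltW rho0)//; lra.
(* Deep enough for the strips of level [N] to have height at most [rho], since [strips] exceeds its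
   index. *)
pose d := Num.truncn rho^-1; pose N := (n + d)%N.
set S : R := (strips q N)%:R.
have S0 : 0 < S by rewrite ltr0n strips_gt0.
have rS : 1 <= rho * S.
  rewrite -ler_pdivrMl// mulr1 (le_trans (ltW (truncnS_gt _)))// ler_nat.
  by apply: leq_trans (ltn_strips N); rewrite ltnS leq_addl.
(* The values on [X] spread over at most [K * rho * S] strip heights; rounding costs at most one
   more, and [1 <= rho * S]. *)
pose T := Num.truncn ((K + 2) * (rho * S)).
have T0 : 0 <= (K + 2) * (rho * S) by apply: mulr_ge0; lra.
have stT x y : X x -> X y -> (st N x <= st N y + T)%N.
  move=> Xx Xy; rewrite -leq_subLR truncn_ge_nat//.
  have [] := leqP (st N x) (st N y) => [|/ltnW] xy.
    by rewrite (eqP xy : _ - _ = 0)%N.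
  rewrite natrB//.
  have /andP[hx _] := zigzag_itv p_odd q_gt0 N x.
  have /andP[_ hy] := zigzag_itv p_odd q_gt0 N y.
  rewrite ler_pdivrMr// in hx; rewrite ler_pdivlMr// -natr1 in hy.
  have /(ler_normlP _ _)[_ h] := (XX x y Xx Xy).2.
  have := ler_wpM2r (ltW S0) h.
  rewrite -/S in hx hy *; rewrite mulrBl.
  have E : (K + 2) * (rho * S) = K * rho * S + 2 * (rho * S) by ring.
  by move: hx hy rS; rewrite E; lra.
have ce x y : X x -> X y -> (cell p q n x <= (cell p q n y).+1)%N.
  move=> Xx Xy; apply: (cell_close p_odd q_gt0).
  exact: le_trans (XX x y Xx Xy).1 rhon.
have [r rP] := choice (fun ab : nat * nat =>
  stripe_descendants R p_odd q_gt0 n d ab.1 ab.2).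
(* At level [n], the cell of [x0] and its neighbours; at level [N], the strips within [T] of that of
   [x0]. Truncation of the subtractions at 0 only adds candidates. *)
pose I := [seq (a, b) | a <- iota (cell p q n x0).-1 3,
                        b <- iota (st N x0 - T) (2 * T + 1)].
pose s := flatten [seq r ab | ab <- I].
have ssize : (size s * laps p n = 3 * (2 * T + 1) * laps p N)%N.
  rewrite size_flatten /shape -map_comp.
  have -> : (3 * (2 * T + 1) = size I)%N by rewrite size_allpairs !size_iota.
  clear s; elim: I => //= ab I IHI; rewrite mulnDl IHI mulSn.
  by have [->] := rP ab.
have Xs x : X x -> exists2 k, k \in s & 0 <= x /\ cell p q N x = k.
  move=> Xx; exists (cell p q N x); last by split => //; exact: X0.
  apply/flatten_mapP; exists (cell p q n x, st N x); last exact: (rP (_, _)).2.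
  apply/allpairsP; exists (cell p q n x, st N x); split=> //=.
    by rewrite !inE; have := ce _ _ Xx Xx0; have := ce _ _ Xx0 Xx; lia.
  by rewrite mem_iota; have := stT _ _ Xx Xx0; have := stT _ _ Xx0 Xx; lia.
have := leb_cover_seq (fun k _ => leb_cell N k) Xs.
move=> /le_trans; apply; rewrite lee_fin.
have L0 m : 0 < (laps p m)%:R :> R by rewrite ltr0n (laps_gt0 p_odd).
rewrite cellsE natrM invfM mulrCA ler_pdivlMr//.
have -> : (laps p N)%:R^-1 * ((size s)%:R * S^-1) * (laps p n)%:R =
    (size s * laps p n)%:R / (laps p N)%:R / S :> R.
  by rewrite natrM; ring.
rewrite ssize natrM mulfK ?gt_eqF// ler_pdivrMr// natrM natrD natrM.
have : T%:R <= (K + 2) * (rho * S) by rewrite truncn_le.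
by move: rS; move: (T%:R) => t; nra.
Qed.

End zigzag_occupation.

(** * Growth of the numbers of laps, strips and cells *)

Section growth.
Variable R : realType.
Variable th : R.
Hypothesis th01 : 0 < th <= 1.

(** Quadratic exponents make consecutive levels comparable up to an arbitrarily small power, with
    [laps] close to the power [th] of [cells]. The summand [n] in [strip_exp] keeps the strip ratios
    above 1 even for [th = 1]; base 3 keeps the lap ratios odd. *)
Definition lap_exp n := Num.truncn (th * n%:R ^+ 2).
Definition strip_exp n := (Num.truncn ((1 - th) * n%:R ^+ 2) + n)%N.
Definition lap_ratio n := (3 ^ (lap_exp n.+1 - lap_exp n))%N.
Definition strip_ratio n := (3 ^ (strip_exp n.+1 - strip_exp n))%N.

Let le_truncn_sq (c : R) n : 0 <= c ->
  (Num.truncn (c * n%:R ^+ 2)%R <= Num.truncn (c * n.+1%:R ^+ 2)%R)%N.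
Proof.
move=> c0; apply: le_truncn; rewrite ler_wpM2l// lerXn2r ?nnegrE ?ler0n//.
by rewrite ler_nat.
Qed.

Let th_ge0 : 0 <= th. Proof. by case/andP: th01 => /ltW. Qed.
Let thC_ge0 : 0 <= 1 - th. Proof. by case/andP: th01; lra. Qed.

Lemma lap_ratio_odd n : odd (lap_ratio n).
Proof. by rewrite oddX orbT. Qed.

Lemma strip_ratio_gt1 n : (1 < strip_ratio n)%N.
Proof.
rewrite /strip_ratio -[1%N](expn0 3) ltn_exp2l// subn_gt0 /strip_exp addnS ltnS.
by rewrite leq_add2r le_truncn_sq.
Qed.

Lemma laps_exp n : laps lap_ratio n = (3 ^ lap_exp n)%N.
Proof.
elim: n => [|n IHn]; first by rewrite /laps big_ord0 /lap_exp expr2 !mulr0 truncn0.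
rewrite /laps big_ord_recr /= -/(laps _ _) IHn -expnD subnKC//.
exact: le_truncn_sq.
Qed.

Lemma strips_exp n : strips strip_ratio n = (3 ^ strip_exp n)%N.
Proof.
elim: n => [|n IHn].
  by rewrite /strips big_ord0 /strip_exp expr2 !mulr0 truncn0.
rewrite /strips big_ord_recr /= -/(strips _ _) IHn -expnD subnKC//.
by rewrite /strip_exp leq_add// le_truncn_sq.
Qed.

Lemma lap_exp_itv n :
  th * n%:R ^+ 2 - 1 <= (lap_exp n)%:R <= th * n%:R ^+ 2.
Proof.
rewrite truncn_le mulr_ge0 ?sqr_ge0// andbT lerBlDr natr1.
exact: ltW (truncnS_gt _).
Qed.

Lemma strip_exp_itv n : (1 - th) * n%:R ^+ 2 + n%:R - 1 <= (strip_exp n)%:R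
  <= (1 - th) * n%:R ^+ 2 + n%:R.
Proof.
rewrite /strip_exp natrD lerD2r truncn_le mulr_ge0 ?sqr_ge0// andbT.
rewrite lerBlDr addrAC lerD2r natr1; exact: ltW (truncnS_gt _).
Qed.

Notation P n := ((laps lap_ratio n)%:R : R).
Notation M n := ((cells lap_ratio strip_ratio n)%:R : R).

Lemma cells_exp n : M n = 3%:R `^ ((lap_exp n)%:R + (strip_exp n)%:R).
Proof.
by rewrite cellsE laps_exp strips_exp -expnD natrX -powR_mulrn// natrD.
Qed.

Lemma laps_powR n : P n = 3%:R `^ (lap_exp n)%:R.
Proof. by rewrite laps_exp natrX -powR_mulrn. Qed.

Let powR3D (x y : R) : 3%:R `^ x * 3%:R `^ y = 3%:R `^ (x + y) :> R.
Proof. by rewrite powRD// (_ : 3%:R == 0 = false) ?implybT//; apply/eqP; lra. Qed.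

Let le_powR3 (x y : R) : x <= y -> 3%:R `^ x <= 3%:R `^ y :> R.
Proof. by move=> xy; apply: ler_powR => //; lra. Qed.

(** In exponents of 3, this compares [(th - eps) * n ^ 2] with [th * n ^ 2] up to linear terms,
    which [eps * n ^ 2] absorbs at the cost of a constant. The next two lemmas work in the same
    way. *)
Lemma cells_succ_le_laps (eps : R) : 0 < eps <= th -> exists2 C, 0 < C &
  forall n, M n.+1 `^ (th - eps) <= C * P n.
Proof.
move=> /andP[e0 et]; exists (3%:R `^ (4 + 9 / eps)); first by rewrite powR_gt0.
move=> n; rewrite cells_exp laps_powR powR3D -powRrM; apply: le_powR3.
have /andP[_ a1] := lap_exp_itv n.+1; have /andP[_ a2] := strip_exp_itv n.+1.
have /andP[a3 _] := lap_exp_itv n.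
have th1 : th <= 1 by case/andP: th01.
rewrite -natr1 in a1 a2; set x := n%:R in a1 a2 a3 *.
have x0 : 0 <= x by rewrite ler0n.
set i := 9 / eps.
have i0 : 0 <= i by rewrite divr_ge0// ltW.
have ie : i * eps = 9 by rewrite divfK ?gt_eqF.
have h1 : (lap_exp n.+1)%:R + (strip_exp n.+1)%:R <= (x + 1) ^+ 2 + (x + 1).
  by move: a1 a2; set u := (x + 1) ^+ 2; lra.
have h2 : ((lap_exp n.+1)%:R + (strip_exp n.+1)%:R) * (th - eps) <=
    ((x + 1) ^+ 2 + (x + 1)) * (th - eps) by apply: ler_wpM2r => //; lra.
apply: (le_trans h2).
(* The square gives [6 * x <= eps * x ^ 2 + 9 / eps], which is where [9 / eps] in the constant comes
   from. *)
have h3 : 0 <= eps * (x - 3 / eps) ^+ 2 by rewrite mulr_ge0 ?sqr_ge0// ltW.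
have h4 : eps * (x - 3 / eps) ^+ 2 = eps * x ^+ 2 - 6 * x + i.
  by rewrite /i; field; rewrite gt_eqF.
by move: h3 a3; rewrite h4; nra.
Qed.

Lemma laps_succ_le_cells (eps : R) : 0 < eps -> exists2 C, 0 < C &
  forall n, P n.+1 <= C * M n `^ (th + eps).
Proof.
move=> e0; exists (3%:R `^ (4 + 3 * eps + 9 / eps)); first by rewrite powR_gt0.
move=> n; rewrite cells_exp laps_powR -powRrM powR3D; apply: le_powR3.
have /andP[_ a1] := lap_exp_itv n.+1; have /andP[a2 _] := strip_exp_itv n.
have /andP[a3 _] := lap_exp_itv n.
have /andP[t0 t1] := th01.
rewrite -natr1 in a1; set x := n%:R in a1 a2 a3 *.
have x0 : 0 <= x by rewrite ler0n.
set i := 9 / eps.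
have h1 : x ^+ 2 + x - 2 <= (lap_exp n)%:R + (strip_exp n)%:R.
  by move: a2 a3; set u := x ^+ 2; lra.
have h2 : (x ^+ 2 + x - 2) * (th + eps) <=
    ((lap_exp n)%:R + (strip_exp n)%:R) * (th + eps) by apply: ler_wpM2r => //; lra.
apply: (le_trans a1); move: h2; set v := (_ + _) * _ => h2.
have h3 : 0 <= eps * (x - 3 / eps) ^+ 2 by rewrite mulr_ge0 ?sqr_ge0// ltW.
have h4 : eps * (x - 3 / eps) ^+ 2 = eps * x ^+ 2 - 6 * x + i.
  by rewrite /i; field; rewrite gt_eqF.
by move: h3 h2; rewrite h4; nra.
Qed.

Lemma cells_succ_le_cells (eps : R) : 0 < eps -> exists2 C, 0 < C &
  forall n, M n.+1 <= C * M n `^ (1 + eps).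
Proof.
move=> e0; exists (3%:R `^ (4 + 3 * eps + 9 / eps)); first by rewrite powR_gt0.
move=> n; rewrite !cells_exp -powRrM powR3D; apply: le_powR3.
have /andP[_ a1] := lap_exp_itv n.+1; have /andP[_ a4] := strip_exp_itv n.+1.
have /andP[a3 _] := lap_exp_itv n; have /andP[a2 _] := strip_exp_itv n.
rewrite -natr1 in a1 a4; set x := n%:R in a1 a2 a3 a4 *.
have x0 : 0 <= x by rewrite ler0n.
set i := 9 / eps.
have h1 : x ^+ 2 + x - 2 <= (lap_exp n)%:R + (strip_exp n)%:R.
  by move: a2 a3; set u := x ^+ 2; lra.
have h2 : (x ^+ 2 + x - 2) * (1 + eps) <=
    ((lap_exp n)%:R + (strip_exp n)%:R) * (1 + eps) by apply: ler_wpM2r => //; lra.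
have h5 : (lap_exp n.+1)%:R + (strip_exp n.+1)%:R <= (x + 1) ^+ 2 + (x + 1).
  by move: a1 a4; set u := (x + 1) ^+ 2; lra.
apply: (le_trans h5); move: h2; set v := (_ + _) * (1 + eps) => h2.
have h3 : 0 <= eps * (x - 3 / eps) ^+ 2 by rewrite mulr_ge0 ?sqr_ge0// ltW.
have h4 : eps * (x - 3 / eps) ^+ 2 = eps * x ^+ 2 - 6 * x + i.
  by rewrite /i; field; rewrite gt_eqF.
by move: h3 h2; rewrite h4; nra.
Qed.

(** Level [n.+1] is the first whose cells are narrower than [rho]; it is not level 0, whose cells
    have width 1. *)
Lemma cells_scale (rho : R) : 0 < rho <= 1 ->
  exists n, (M n.+1)^-1 < rho <= (M n)^-1.
Proof.
move=> /andP[r0 r1].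
have q0 n := ltnW (strip_ratio_gt1 n).
have M0 n : 0 < M n by rewrite ltr0n (cells_gt0 lap_ratio_odd q0).
have exn : exists n, (M n)^-1 < rho.
  exists (Num.truncn rho^-1).+1; rewrite invf_plt ?posrE//.
  apply: (lt_le_trans (truncnS_gt _)); rewrite ler_nat.
  apply: leq_trans (ltnW (ltn_strips strip_ratio_gt1 _)) _.
  by rewrite cellsE leq_pmull// (laps_gt0 lap_ratio_odd).
case: (ex_minnP exn) => -[|n] hn nmin.
  by move: hn; rewrite /cells big_ord0 invr1 ltNge r1.
exists n; rewrite hn leNgt; apply/negP => /nmin; rewrite ltnn => //.
Qed.

Notation f := (zigzag lap_ratio strip_ratio : R -> R).

(** At the level [n] of [cells_scale], [leb_zigzag] gives a multiple of [rho / laps n]. By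
    [cells_succ_le_laps] and [rho^-1 < M n.+1], the factor [1 / laps n] is at most a multiple of
    [rho ^ (th - eps)]. *)
Lemma leb_zigzag_powR (eps K : R) : 0 < eps <= th -> 0 <= K ->
  exists2 C, 0 < C & forall (rho : R) (X : set R), 0 < rho <= 1 ->
  (forall x, X x -> 0 <= x) ->
  (forall x y, X x -> X y -> `|x - y| <= rho /\ `|f x - f y| <= K * rho) ->
  (leb X <= (C * rho `^ (1 + th - eps))%:E)%E.
Proof.
move=> et K0; have [C C0 CP] := cells_succ_le_laps et.
have /andP[e0 eth] := et.
exists (3 * (2 * K + 5) * C).
  by rewrite mulr_gt0// mulr_gt0//; lra.
move=> rho X r01 X0 XX; have /andP[r0 r1] := r01.
have [n /andP[n1 n2]] := cells_scale r01.
apply: (le_trans (leb_zigzag lap_ratio_odd strip_ratio_gt1 K0 r0 n2 X0 XX)).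
have q0 k := ltnW (strip_ratio_gt1 k).
have P0 : 0 < P n by rewrite ltr0n (laps_gt0 lap_ratio_odd).
have M0 : 0 < M n.+1 by rewrite ltr0n (cells_gt0 lap_ratio_odd q0).
rewrite lee_fin -!mulrA ler_pM2l// ler_pM2l; last by lra.
rewrite -addrA powRD; last by apply/implyP; rewrite (gt_eqF r0).
rewrite powRr1 ?(ltW r0)// mulrCA ler_pM2l//.
rewrite -[leLHS]mul1r ler_pdivrMr// -mulrA [_ * P n]mulrC mulrA.
apply: (@le_trans _ _ (M n.+1 `^ (th - eps) * rho `^ (th - eps))); last first.
  by rewrite ler_wpM2r// powR_ge0.
rewrite -powRM ?(ltW r0) ?(ltW M0)//.
apply: (@le_trans _ _ (1 `^ (th - eps))); first by rewrite powR1.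
apply: ge0_ler_powR; rewrite ?nnegrE ?mulr_ge0 ?(ltW r0) ?(ltW M0)//.
  by rewrite subr_ge0.
by rewrite -ler_pdivrMl// mulr1 ltW.
Qed.

End growth.

(** * Dimension estimates *)

Section dimension_bounds.
Context {R : realType} {d : nat}.
Implicit Types (E U : set 'rV[R]_d) (delta rho s t : R).

(** Diameter in the sup norm: it fits cubes exactly and is at most the Euclidean diameter, so one
    mass bound serves both dimensions. *)
Definition coordinatewise_diam_le U rho :=
  forall x y, U x -> U y -> forall i, `|x 0 i - y 0 i| <= rho.

Lemma coord_le_euclidean_dist (x y : 'rV[R]_d) i :
  `|x 0 i - y 0 i| <= euclidean_dist x y.
Proof.
rewrite -sqrtr_sqr /euclidean_dist ler_wsqrtr// (bigD1 i)//= lerDl.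
by apply: sumr_ge0 => j _; exact: sqr_ge0.
Qed.

Lemma euclidean_dist_le (x y : 'rV[R]_d) rho : 0 <= rho ->
  (forall i, `|x 0 i - y 0 i| <= rho) -> euclidean_dist x y <= d%:R * rho.
Proof.
move=> r0 h; rewrite -(ler_pXn2r (n := 2))// ?nnegrE ?sqrtr_ge0 ?mulr_ge0//.
rewrite sqr_sqrtr ?sumr_ge0// => [|i _]; last exact: sqr_ge0.
apply: (@le_trans _ _ (\sum_(i < d) rho ^+ 2)).
  apply: ler_sum => i _; rewrite -[leLHS]real_normK ?num_real//.
  by rewrite lerXn2r ?nnegrE.
rewrite sumr_const card_ord -[leLHS]mulr_natl exprMn ler_wpM2r ?sqr_ge0//.
by rewrite -natrX ler_nat -[leqLHS]muln1 expnS expn1 leq_mul2l; case: d.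
Qed.

Lemma diam_ge0 U x : U x -> (0 <= diam U)%E.
Proof.
move=> Ux; apply: ereal_sup_ubound; exists (x, x) => //=.
by rewrite /euclidean_dist big1 ?sqrtr0// => i _; rewrite subrr expr0n.
Qed.

Lemma diam_pow_ge0 s U : (0 <= diam_pow s U)%E.
Proof. by rewrite /diam_pow; case: ifP => // _; exact: poweR_ge0. Qed.

Lemma coord_diam_le U rho : (diam U <= rho%:E)%E -> coordinatewise_diam_le U rho.
Proof.
move=> Ur x y Ux Uy i; rewrite -lee_fin; apply: le_trans Ur.
apply: (@le_trans _ _ (euclidean_dist x y)%:E).
  by rewrite lee_fin coord_le_euclidean_dist.
by apply: ereal_sup_ubound; exists (x, y).
Qed.

Lemma diam_coord_le U rho : 0 <= rho -> coordinatewise_diam_le U rho ->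
  (diam U <= (d%:R * rho)%:E)%E.
Proof.
move=> r0 Ur; apply: ge_ereal_sup => _ [[x y] [Ux Uy] <-] /=.
by rewrite lee_fin euclidean_dist_le// => i; exact: Ur.
Qed.

Lemma cube_coord_diam (a : 'rV[R]_d) delta :
  coordinatewise_diam_le (cube a delta) delta.
Proof.
move=> x y xa ya i; have := xa i; have := ya i.
by rewrite ler_norml => /andP[? ?] /andP[? ?]; apply/andP; split; lra.
Qed.

Definition box_counting_upper E s := exists2 C, 0 < C &
  forall delta, 0 < delta < 1 ->
  exists2 n, covered_by_cubes delta E n & n%:R <= C * delta `^ (- s).

(** Frostman's condition, for a set function on all sets. *)
Definition mass_bound (nu : set 'rV[R]_d -> \bar R) s := exists2 C, 0 < C &
  forall rho U, 0 < rho <= 1 -> coordinatewise_diam_le U rho ->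
    (nu U <= (C * rho `^ s)%:E)%E.

(** Padded with empty sets, since the covers of [hausdorff_premeasure] are infinite sequences. *)
Definition seq_of_cubes n (a : 'I_n -> 'rV[R]_d) delta k : set 'rV[R]_d :=
  if insub k is Some i then cube (a i) delta else set0.

Lemma cover_seq_of_cubes n (a : 'I_n -> 'rV[R]_d) delta :
  \bigcup_i cube (a i) delta `<=` \bigcup_k seq_of_cubes a delta k.
Proof. by move=> x [i _ xi]; exists (val i) => //; rewrite /seq_of_cubes valK. Qed.

Lemma seq_of_cubes_coord_diam n (a : 'I_n -> 'rV[R]_d) delta k :
  coordinatewise_diam_le (seq_of_cubes a delta k) delta.
Proof. by rewrite /seq_of_cubes; case: insubP => [i _ _|_ x y []]; exact: cube_coord_diam. Qed.

Lemma seq_of_cubes_ge n (a : 'I_n -> 'rV[R]_d) delta k :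
  (n <= k)%N -> seq_of_cubes a delta k = set0.
Proof. by move=> nk; rewrite /seq_of_cubes insubF// ltnNge nk. Qed.

(** At scale [r] the cover by cubes has total weight of order at most [r ^ (t - s)], which tends to
    0. *)
Lemma hausdorff_measure_eq0 E s t : box_counting_upper E s -> 0 < t -> s < t ->
  hausdorff_measure t E = 0%E.
Proof.
move=> [C C0 EC] t0 st.
have ge0 delta : (0 <= hausdorff_premeasure t delta E)%E.
  apply: le_ereal_inf_tmp => _ [U _ <-]; apply: nneseries_ge0 => k _ _.
  exact: diam_pow_ge0.
have small delta : 0 < delta -> (hausdorff_premeasure t delta E <= 0)%E.
  move=> delta0; apply/lee_addgt0Pr => eta eta0; rewrite add0e.
  pose D := C * d.+1%:R `^ t; have D0 : 0 < D by rewrite mulr_gt0 ?powR_gt0.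
  (* The three bounds give [r < 1], diameters at most [delta] and total weight at most [eta]. The
     dimension enters as [d.+1] to be positive also for [d = 0]. *)
  pose r := Num.min 2^-1 (Num.min (delta / d.+1%:R) ((eta / D) `^ (t - s)^-1)).
  have r0 : 0 < r.
    by rewrite !lt_min invr_gt0 ltr0n /= divr_gt0//= powR_gt0// divr_gt0.
  have r1 : r < 1 by rewrite gt_min; apply/orP; left; lra.
  have [n [a Ea] nC] := EC r (introT andP (conj r0 r1)).
  have dU k : (diam (seq_of_cubes a r k) <= (d.+1%:R * r)%:E)%E.
    apply: le_trans (diam_coord_le (ltW r0) (@seq_of_cubes_coord_diam _ a r k)) _.
    by rewrite lee_fin ler_pM2r// ler_nat.
  have dr : d.+1%:R * r <= delta.
    by rewrite mulrC -ler_pdivlMr// /r !ge_min lexx !orbT.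
  apply: (@le_trans _ _ (\sum_(0 <= k <oo) diam_pow t (seq_of_cubes a r k))%E).
    apply: ereal_inf_lbound; exists (seq_of_cubes a r) => //; split.
      exact: subset_trans Ea (@cover_seq_of_cubes _ _ _).
    by move=> k; apply: le_trans (dU k) _; rewrite lee_fin.
  apply: (@le_trans _ _ (n%:R * (d.+1%:R * r) `^ t)%:E).
    apply: nneseries_le_const => k; first exact: diam_pow_ge0.
      move=> _; rewrite /diam_pow; case: ifPn => [_|/set0P[x Ux]].
        by rewrite lee_fin powR_ge0.
      rewrite -poweR_EFin; apply: gt0_ler_poweR => //; first exact: ltW.
        by rewrite in_itv /= (diam_ge0 Ux) leey.
      by rewrite in_itv /= lee_fin mulr_ge0 ?(ltW r0)// leey.
    by move=> nk; rewrite /diam_pow seq_of_cubes_ge// eqxx.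
  rewrite lee_fin powRM ?(ltW r0)//.
  apply: (@le_trans _ _ (D * r `^ (t - s))).
    rewrite powRD; last by apply/implyP; rewrite (gt_eqF r0).
    have := powR_ge0 r t; have := powR_ge0 d.+1%:R t; move: nC; rewrite /D.
    set u := r `^ (- s); set v := d.+1%:R `^ t; set w := r `^ t => h v0 w0.
    have -> : C * v * (w * u) = (C * u) * (v * w) by ring.
    by rewrite ler_wpM2r// mulr_ge0.
  rewrite mulrC -ler_pdivlMr//.
  have ts : 0 < t - s by rewrite subr_gt0.
  apply: (@le_trans _ _ (((eta / D) `^ (t - s)^-1) `^ (t - s))).
    by apply: ge0_ler_powR; rewrite ?nnegrE ?powR_ge0 ?(ltW ts) ?(ltW r0)// !ge_min lexx !orbT.
  by rewrite -powRrM mulVf ?gt_eqF// powRr1// ltW// divr_gt0.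
apply/eqP; rewrite eq_le; apply/andP; split.
  by apply: ge_ereal_sup => _ [delta delta0 <-]; exact: small.
apply: le_trans (ge0 1) _; apply: ereal_sup_ubound; exists 1 => //=.
Qed.

Lemma mass_le_diam_pow (nu : set 'rV[R]_d -> \bar R) s t : nu set0 = 0%E ->
  0 <= t -> t < s -> mass_bound nu s -> exists2 C, 0 < C &
  forall U, (diam U <= 1)%E -> (nu U <= C%:E * diam_pow t U)%E.
Proof.
move=> nu0 t0 ts [C C0 nuC]; exists C => // U U1.
have [->|U0] := eqVneq U set0; first by rewrite nu0 /diam_pow eqxx mule0.
have /set0P[x Ux] := U0; have dU0 := diam_ge0 Ux.
have s0 : 0 < s by apply: le_lt_trans ts.
rewrite /diam_pow (negbTE U0).
case dE : (diam U) => [r| |]; [|by rewrite dE in U1|by rewrite dE in dU0].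
rewrite dE !lee_fin in dU0 U1.
have Ur : coordinatewise_diam_le U r by apply: coord_diam_le; rewrite dE.
rewrite poweR_EFin -EFinM.
have [r0|r0] := eqVneq r 0; last first.
  have rgt0 : 0 < r by rewrite lt_def r0.
  have := nuC r U (introT andP (conj rgt0 U1)) Ur => /le_trans; apply.
  by rewrite lee_fin ler_pM2l// ger_powR ?rgt0// ltW.
(* A set of diameter 0 satisfies the mass bound at every scale [rho], so its mass vanishes. *)
apply: (@le_trans _ _ 0%E); last by rewrite lee_fin mulr_ge0 ?powR_ge0// ltW.
apply/lee_addgt0Pr => eta eta0; rewrite add0e.
pose rho := Num.min 1 ((eta / C) `^ s^-1).
have rho0 : 0 < rho by rewrite lt_min ltr01/= powR_gt0// divr_gt0.
have rho1 : 0 < rho <= 1 by rewrite rho0 ge_min lexx.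
have Urho : coordinatewise_diam_le U rho.
  by move=> a b Ua Ub i; apply: le_trans (Ur a b Ua Ub i) _; rewrite r0 ltW.
apply: le_trans (nuC _ _ rho1 Urho) _; rewrite lee_fin mulrC -ler_pdivlMr//.
apply: (@le_trans _ _ (((eta / C) `^ s^-1) `^ s)).
  apply: ge0_ler_powR; rewrite ?nnegrE ?powR_ge0 ?(ltW s0) ?(ltW rho0)//.
  by rewrite ge_min lexx orbT.
by rewrite -powRrM mulVf ?gt_eqF// powRr1// ltW// divr_gt0.
Qed.

(** Mass distribution principle: a cover of total weight below [c / C] would carry a mass below
    [c]. *)
Lemma hausdorff_measure_neq0 E (nu : set 'rV[R]_d -> \bar R) (c s t : R) :
  sigma_subadditive nu -> (forall U V, U `<=` V -> (nu U <= nu V)%E) ->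
  (forall U, (0 <= nu U)%E) -> nu set0 = 0%E ->
  0 < c -> (c%:E <= nu E)%E -> 0 <= t -> t < s -> mass_bound nu s ->
  hausdorff_measure t E <> 0%E.
Proof.
move=> nuS nuM nu_ge0 nu0 c0 cE t0 ts nus H0.
have [C C0 nuC] := mass_le_diam_pow nu0 t0 ts nus.
have : (hausdorff_premeasure t 1 E < (c / C)%:E)%E.
  apply: (@le_lt_trans _ _ 0%E); last by rewrite lte_fin divr_gt0.
  by rewrite -H0; apply: ereal_sup_ubound; exists 1 => //=.
move=> /ereal_inf_lt[_ [U [EU U1] <-]]; apply/negP; rewrite -leNgt.
rewrite EFinM muleC lee_pdivrMl//; apply: le_trans cE _.
rewrite -nneseriesZl; last by move=> k _; exact: diam_pow_ge0.
apply: le_trans (nuM _ _ EU) _; apply: le_trans (nuS _) _.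
by apply: lee_nneseries => [k _ _|k _]; [exact: nu_ge0|exact: nuC].
Qed.

Lemma covering_numberP delta E n : covered_by_cubes delta E n ->
  covered_by_cubes delta E (covering_number delta E) /\
  (covering_number delta E <= n)%N.
Proof.
move=> En; have ex : exists m, `[< covered_by_cubes delta E m >].
  by exists n; apply/asboolP.
have : exists m, [set m | covered_by_cubes delta E m /\
    forall k, covered_by_cubes delta E k -> (m <= k)%N] m.
  case: (ex_minnP ex) => m /asboolP Em mmin; exists m; split=> // k Ek.
  by apply: mmin; apply/asboolP.
by move=> /(xgetPex 0%N)[h1 h2]; split => //; exact: h2.
Qed.

(** Each cube has mass at most a multiple of [delta ^ s], and together the cubes carry at least
    [c]. *)
Lemma mass_le_covering (nu : set 'rV[R]_d -> \bar R) E (c s : R) :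
  sigma_subadditive nu -> (forall U V, U `<=` V -> (nu U <= nu V)%E) ->
  (forall U, (0 <= nu U)%E) -> nu set0 = 0%E ->
  0 < c -> (c%:E <= nu E)%E -> mass_bound nu s ->
  exists2 C, 0 < C & forall delta n, 0 < delta <= 1 ->
    covered_by_cubes delta E n -> C * delta `^ (- s) <= n%:R.
Proof.
move=> nuS nuM nu_ge0 nu0 c0 cE [C C0 nuC].
exists (c / C); first by rewrite divr_gt0.
move=> delta n d01 [a Ea]; have /andP[d0 d1] := d01.
rewrite powRN ler_pdivrMr ?powR_gt0// ler_pdivrMr// -mulrA [_ * C]mulrC.
rewrite -lee_fin; apply: (le_trans cE).
apply: le_trans (nuM _ _ (subset_trans Ea (@cover_seq_of_cubes _ a delta))) _.
apply: le_trans (nuS _) _; apply: nneseries_le_const => // k.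
  by move=> _; apply: nuC => //; exact: seq_of_cubes_coord_diam.
by move=> nk; rewrite seq_of_cubes_ge.
Qed.

Lemma has_box_dim_of_bounds E s :
  (forall eps, 0 < eps -> box_counting_upper E (s + eps)) ->
  (forall eps, 0 < eps -> exists2 C, 0 < C & forall delta n, 0 < delta <= 1 ->
    covered_by_cubes delta E n -> C * delta `^ (- (s - eps)) <= n%:R) ->
  has_box_dim E s.
Proof.
move=> up low; apply/cvgrPdist_le => /= eps eps0.
have e2 : 0 < eps / 2 by rewrite divr_gt0.
have [C C0 upC] := up _ e2; have [c c0 lowc] := low _ e2.
near=> delta.
have d0 : 0 < delta by near: delta; exact: nbhs_right_gt.
have d1 : delta < 1 by near: delta; exact: nbhs_right_lt.
(* For such [delta] the logarithms of both constants cost at most [eps / 2] times [- ln delta]; the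
   other [eps / 2] is spent on the exponents. *)
have dB : delta < expR (- ((2 / eps) * (`|ln C| + `|ln c|))).
  by near: delta; apply: nbhs_right_lt; exact: expR_gt0.
have [n En nC] := upC delta (introT andP (conj d0 d1)).
have [EN Nn] := covering_numberP En.
have := lowc delta _ (introT andP (conj d0 (ltW d1))) EN.
set N := covering_number delta E in EN Nn *.
have := le_trans (_ : N%:R <= n%:R :> R) nC; rewrite ler_nat => /(_ Nn) Nup Nlow.
have N0 : 0 < N%:R :> R.
  by apply: lt_le_trans Nlow; rewrite mulr_gt0 ?powR_gt0.
set L := - ln delta.
have LB : (2 / eps) * (`|ln C| + `|ln c|) < L.
  by rewrite /L ltrNr -ltr_expR lnK.
have L0 : 0 < L by rewrite /L oppr_gt0 ln_lt0// d0.
have up' : ln N%:R <= ln C + (s + eps / 2) * L.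
  have := Nup; rewrite -ler_ln ?posrE// ?mulr_gt0 ?powR_gt0//.
  by rewrite lnM ?posrE ?powR_gt0// ln_powR /L mulNr mulrN.
have low' : ln c + (s - eps / 2) * L <= ln N%:R.
  have := Nlow; rewrite -ler_ln ?posrE// ?mulr_gt0 ?powR_gt0//.
  by rewrite lnM ?posrE ?powR_gt0// ln_powR /L mulNr mulrN.
have LB' : `|ln C| + `|ln c| <= eps / 2 * L.
  by rewrite -ler_pdivrMl// invf_div ltW.
have := ler_norm (ln C); have := ler_norm (- ln c); rewrite normrN => h1 h2.
have p1 := normr_ge0 (ln C); have p2 := normr_ge0 (ln c).
rewrite distrC ler_distl ler_pdivlMr// ler_pdivrMr//.
by move: up' low' LB'; rewrite !mulrDl !mulNr => up' low' LB'; apply/andP; split; lra.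
Unshelve. all: by end_near.
Qed.

Lemma dims_of_bounds E (nu : set 'rV[R]_d -> \bar R) (c s : R) :
  sigma_subadditive nu -> (forall U V, U `<=` V -> (nu U <= nu V)%E) ->
  (forall U, (0 <= nu U)%E) -> nu set0 = 0%E ->
  0 < c -> (c%:E <= nu E)%E -> 0 < s ->
  (forall eps, 0 < eps -> box_counting_upper E (s + eps)) ->
  (forall t, 0 < t < s -> mass_bound nu t) ->
  hausdorff_dim E = s%:E /\ has_box_dim E s.
Proof.
move=> nuS nuM nu_ge0 nu0 c0 cE s0 up low; split; last first.
  apply: has_box_dim_of_bounds => // eps eps0.
  (* The maximum keeps [t] positive when [eps] is large. *)
  pose t := Num.max (s - eps) (s / 2).
  have ts : 0 < t < s by rewrite lt_max gt_max; apply/andP; split; lra.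
  have [C C0 CP] := mass_le_covering nuS nuM nu_ge0 nu0 c0 cE (low t ts).
  exists C => // delta n d01 /(CP _ _ d01); apply: le_trans.
  by rewrite ler_pM2l// ger_powR// lerN2 le_max lexx.
apply/eqP; rewrite eq_le; apply/andP; split.
  apply/lee_addgt0Pr => eps eps0; rewrite -EFinD.
  apply: ereal_inf_lbound; exists (s + eps) => //; split; first lra.
  by apply: (hausdorff_measure_eq0 (up (eps / 2) _)); lra.
apply: le_ereal_inf_tmp => _ [t [t0 Ht] <-]; rewrite lee_fin leNgt.
apply/negP => ts; have ts' : 0 < (t + s) / 2 < s by lra.
apply: (hausdorff_measure_neq0 nuS nuM nu_ge0 nu0 c0 cE t0 _ (low _ ts') Ht).
lra.
Qed.

End dimension_bounds.

(** * Dimensions of the graph of a function of the zigzag *)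

Section graph_dimension.
Variable R : realType.
Variable th : R.
Hypothesis th01 : 0 < th <= 1.

Notation p := (lap_ratio th).
Notation q := (strip_ratio th).
Notation f := (zigzag p q : R -> R).

Let p_odd := lap_ratio_odd th.
Let q_gt0 n := ltnW (strip_ratio_gt1 th01 n).

Definition point (x y : R) : 'rV[R]_2 := \row_i (if i == 0 then x else y).

Lemma pointE (x y : R) : (point x y 0 0 = x) * (point x y 0 1 = y).
Proof. by split; rewrite mxE. Qed.

Lemma forall_ord2 (Q : 'I_2 -> Prop) : Q 0 -> Q 1 -> forall i, Q i.
Proof.
move=> Q0 Q1 [[|[|//]] i2].
- by rewrite (_ : Ordinal i2 = 0)//; exact: val_inj.
- by rewrite (_ : Ordinal i2 = 1)//; exact: val_inj.
Qed.

(** For [delta] between the cell widths of levels [n.+1] and [n], the graph over a cell of level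
    [n.+1] fits in a column of width [delta] and height [2 * w]. In all this takes at most
    [8 * L * P / delta + 2 * M] cubes, with [P] laps and [M] cells at level [n.+1], and the growth
    lemmas bound both terms. *)
Lemma box_counting_graph (F : R -> R) (a : C01 R) (L eps : R) :
  (forall x, a x = F (val x)) -> 0 < L ->
  (forall x y, `|F x - F y| <= L * `|f x - f y|) -> 0 < eps ->
  box_counting_upper (graph a) (1 + th + eps).
Proof.
move=> aF L0 FL eps0.
have [C1 C10 C1P] := laps_succ_le_cells th01 eps0.
have [C2 C20 C2P] := cells_succ_le_cells th01 eps0.
exists (8 * L * C1 + 2 * C2); first by rewrite addr_gt0// !mulr_gt0.
move=> delta /andP[d0 d1].
have d01 : 0 < delta <= 1 by rewrite d0 ltW.
have [n /andP[/ltW n1 n2]] := cells_scale th01 d01.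
set M : R := (cells p q n.+1)%:R in n1.
have M1 : 1 <= M by rewrite ler1n (cells_gt0 p_odd q_gt0).
have M0 : 0 < M by exact: lt_le_trans M1.
set Q : R := (strips q n.+1)%:R.
have Q0 : 0 < Q by rewrite ltr0n (strips_gt0 q_gt0).
pose w := L * (2 / Q).
have w0 : 0 <= w by rewrite mulr_ge0 ?divr_ge0 ?ltW.
have Fw x y : `|x - y| <= M^-1 -> `|F x - F y| <= w.
  move=> xy; apply: le_trans (FL x y) _; rewrite ler_wpM2l ?(ltW L0)//.
  exact: (zigzag_close p_odd q_gt0).
pose r := (Num.truncn (2 * w / delta)).+1.
(* One column more than [cells], because the abscissa 1 has cell index [cells]. *)
pose J := ('I_(cells p q n.+1).+1 * 'I_r)%type.
pose corner (j : J) := point (j.1%:R / M) (F (j.1%:R / M) - w + j.2%:R * delta).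
exists #|{: J}|.
  exists (fun i => corner (enum_val i)) => v [x [v0 v1]].
  have := valP x; rewrite inE /= in_itv /=; set z := val x in v0 * => /andP[z0 z1].
  have Mz0 : 0 <= M * z by rewrite mulr_ge0// ltW.
  have kM : (Num.truncn (M * z) < (cells p q n.+1).+1)%N.
    by rewrite ltnS -[leqRHS](natrK (R := R)) le_truncn// ler_piMr// ltW.
  pose k := Ordinal kM.
  have /andP[kz1 kz2] := truncn_itv Mz0; rewrite -natr1 in kz2.
  have z1' : k%:R / M <= z by rewrite ler_pdivrMr// mulrC.
  have z2' : z <= k%:R / M + M^-1.
    by rewrite -[X in _ + X]mul1r -mulrDl ler_pdivlMr// mulrC ltW.
  have : `|F z - F (k%:R / M)| <= w.
    by apply: Fw; rewrite ger0_norm ?subr_ge0// lerBlDl.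
  rewrite ler_distl => /andP[Fz1 Fz2].
  set g := F z - (F (k%:R / M) - w).
  have g0 : 0 <= g by rewrite subr_ge0.
  have jr : (Num.truncn (g / delta) < r)%N.
    by rewrite ltnS le_truncn// ler_pM2r ?invr_gt0// /g; lra.
  pose j := Ordinal jr.
  have /andP[gj1 gj2] := truncn_itv (divr_ge0 g0 (ltW d0)).
  rewrite ler_pdivlMr// in gj1; rewrite -natr1 ltr_pdivrMr// mulrDl mul1r in gj2.
  exists (enum_rank ((k, j) : J)) => //=; rewrite enum_rankK.
  apply: forall_ord2; rewrite pointE ?v0 ?v1 ?aF -/z /=.
    by rewrite z1' /= (le_trans z2')// lerD2l.
  by move: gj1 gj2; rewrite /g; set u := _ * delta => *; apply/andP; split; lra.
rewrite card_prod !card_ord natrM.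
set P : R := (laps p n.+1)%:R.
have MPQ : M = P * Q by rewrite /M cellsE natrM.
have rle : r%:R <= 2 * w / delta + 1.
  by rewrite /r -natr1 lerD2r truncn_le divr_ge0 ?(ltW d0)// mulr_ge0.
have step1 : (cells p q n.+1).+1%:R * r%:R <= 2 * M * (2 * w / delta + 1).
  by apply: ler_pM => //; rewrite -natr1 -/M; lra.
apply: (le_trans step1).
have -> : 2 * M * (2 * w / delta + 1) = 8 * L * P * delta^-1 + 2 * M.
  by rewrite MPQ /w; field; rewrite !gt_eqF.
set m : R := (cells p q n)%:R in n2.
have m0 : 0 < m by rewrite ltr0n (cells_gt0 p_odd q_gt0).
have md : m <= delta^-1 by rewrite -[leLHS]invrK lef_pV2 ?posrE// invr_gt0.
have dV t : delta^-1 `^ t = delta `^ (- t).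
  by rewrite -(powR_inv1 (ltW d0)) -powRrM mulN1r.
have mpow t : 0 <= t -> m `^ t <= delta `^ (- t).
  move=> t0; rewrite -dV ge0_ler_powR// ?nnegrE ?invr_ge0 ltW//.
have [th0 th1] := andP th01.
have Pd : P * delta^-1 <= C1 * delta `^ (- (1 + th + eps)).
  have -> : - (1 + th + eps) = - (th + eps) + -1 by ring.
  rewrite powRD ?(gt_eqF d0) ?implybT// powR_inv1 ?(ltW d0)// mulrA.
  rewrite ler_pM2r ?invr_gt0//; apply: le_trans (C1P n) _.
  by rewrite ler_pM2l// mpow// addr_ge0// ltW.
have Md : M <= C2 * delta `^ (- (1 + th + eps)).
  apply: le_trans (C2P n) _; rewrite ler_pM2l//.
  apply: le_trans (mpow _ _) _; first by rewrite addr_ge0 ?(ltW eps0).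
  by rewrite ger_powR// lerN2 lerD2r lerDl ltW.
have L8 : 0 <= 8 * L by rewrite mulr_ge0// ltW.
have := ler_wpM2l L8 Pd; move: Md; move: (delta `^ _) delta^-1 => D E; lra.
Qed.

(** The mass of [U] is the Lebesgue measure of the abscissae in [[al, be]] over which the graph lies
    in [U]. There a variation of [F] by [rho] forces one of [f] by at most [rho / c], so
    [leb_zigzag_powR] bounds the mass. *)
Lemma dims_graph (F : R -> R) (a : C01 R) (L c al be : R) :
  (forall x, a x = F (val x)) -> 0 < L ->
  (forall x y, `|F x - F y| <= L * `|f x - f y|) ->
  0 < c -> 0 <= al -> al < be -> be <= 1 ->
  (forall x y, al <= x <= be -> al <= y <= be ->
     c * `|f x - f y| <= `|F x - F y|) ->
  hausdorff_dim (graph a) = (1 + th)%:E /\ has_box_dim (graph a) (1 + th).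
Proof.
move=> aF L0 FL c0 al0 albe be1 Fc; have /andP[th0 th1] := th01.
pose slice (U : set 'rV[R]_2) := [set x | al <= x <= be /\ U (point x (F x))].
pose nu U := leb (slice U).
have sliceM U V : U `<=` V -> slice U `<=` slice V.
  by move=> UV x [? ?]; split => //; exact: UV.
apply: (@dims_of_bounds _ _ _ nu (be - al)).
- move=> U; apply: le_trans (leb_sigma_subadditive _); apply: le_leb.
  by move=> x [xab [k _ Uk]]; exists k.
- by move=> U V UV; apply: le_leb; exact: sliceM.
- by move=> U; exact: leb_ge0.
- by rewrite /nu (_ : slice set0 = set0) ?leb0//; apply/seteqP; split => x // [].
- by rewrite subr_gt0.
- rewrite -leb_itv ?(ltW albe)//; apply: le_leb => x /=; rewrite in_itv /= => xab.
  split => //; have [x1 x2] := andP xab.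
  have xI : x \in (`[0, 1]%classic : set R).
    by rewrite inE /= in_itv /= (le_trans al0 x1) (le_trans x2 be1).
  by exists (exist _ x xI); rewrite !pointE aF.
- by rewrite addr_gt0.
- by move=> eps eps0; exact: box_counting_graph aF L0 FL eps0.
move=> t /andP[t0 ts].
(* The first bound is the range of [leb_zigzag_powR]; the second makes its exponent at least [t]. *)
pose eps := Num.min th (1 + th - t).
have eth : 0 < eps <= th by rewrite lt_min th0 subr_gt0 ts ge_min lexx.
have ci : 0 <= c^-1 by rewrite invr_ge0 ltW.
have [C C0 CP] := leb_zigzag_powR th01 eth ci.
exists C => // rho U r01 Ur; have /andP[r0 _] := r01.
apply: le_trans (CP rho (slice U) r01 _ _) _.
- by move=> x [/andP[x1 _] _]; exact: le_trans x1.
- move=> x y [xab Ux] [yab Uy]; have := Ur _ _ Ux Uy 0; have := Ur _ _ Ux Uy 1.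
  rewrite !pointE => Fxy xy; split => //.
  by rewrite ler_pdivlMl//; apply: le_trans Fxy; exact: Fc.
rewrite lee_fin ler_pM2l// ger_powR//.
have : eps <= 1 + th - t by rewrite ge_min lexx orbT.
lra.
Qed.

End graph_dimension.

(** * Functions of the zigzag and algebraic independence *)

Section tame_functions.
Variable R : realType.
Implicit Types phi chi : R -> R.

Definition C1_pos phi (dphi : R -> R) := forall y : R, 0 < y ->
  is_derive y 1 phi (dphi y) /\ {for y, continuous dphi}.

(** Boundedness makes the Lipschitz condition stable under products. A derivative is asked for on
    positive numbers, where the nonzero values of the zigzag lie. *)
Definition tame phi := exists L, [/\ 0 < L, forall y, `|phi y| <= L,
  forall y z, `|phi y - phi z| <= L * `|y - z| & exists dphi, C1_pos phi dphi].

Lemma lipschitz_continuous phi L : (forall y z, `|phi y - phi z| <= L * `|y - z|) ->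
  continuous phi.
Proof.
move=> phiL x; apply/cvgrPdist_le => /= eps eps0.
have L0 : 0 < `|L| + 1 by rewrite ltr_wpDl.
near=> z; apply: le_trans (phiL x z) _.
apply: (@le_trans _ _ ((`|L| + 1) * `|x - z|)).
  by rewrite ler_wpM2r// (le_trans (ler_norm _))// lerDl.
rewrite -ler_pdivlMl//; near: z.
by apply: (@cvgr_dist_le _ _ _ _ _ id x) => //; rewrite mulr_gt0 ?invr_gt0.
Unshelve. all: by end_near.
Qed.

Lemma C1_pos_continuous phi dphi y : C1_pos phi dphi -> 0 < y ->
  {for y, continuous phi}.
Proof.
move=> h y0; apply: differentiable_continuous; apply/derivable1_diffP.
by case: (h y y0) => -[].
Qed.

Lemma tame_cst (c : R) : tame (fun=> c).
Proof.
exists (`|c| + 1); split=> [|y|y z|]; first by rewrite ltr_wpDl.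
- by rewrite lerDl.
- by rewrite subrr normr0 mulr_ge0// addr_ge0.
- by exists (fun=> 0) => y _; split; [exact: is_derive_cst|exact: cst_continuous].
Qed.

Lemma tameD phi chi : tame phi -> tame chi -> tame (fun y => phi y + chi y).
Proof.
move=> [L [L0 phi1 phi2 [dphi hphi]]] [M [M0 chi1 chi2 [dchi hchi]]].
exists (L + M); split=> [|y|y z|]; first exact: addr_gt0.
- by apply: le_trans (ler_normD _ _) _; exact: lerD.
- rewrite opprD addrACA; apply: le_trans (ler_normD _ _) _.
  by rewrite mulrDl; exact: lerD.
- exists (fun y => dphi y + dchi y) => y y0.
  have [d1 c1] := hphi y y0; have [d2 c2] := hchi y y0.
  by split; [exact: is_deriveD|exact: continuousD].
Qed.

Lemma tameM phi chi : tame phi -> tame chi -> tame (fun y => phi y * chi y).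
Proof.
move=> [L [L0 phi1 phi2 [dphi hphi]]] [M [M0 chi1 chi2 [dchi hchi]]].
have LM : 0 < L * M by exact: mulr_gt0.
exists (2 * (L * M)); split=> [|y|y z|]; first exact: mulr_gt0.
- rewrite normrM; apply: (@le_trans _ _ (L * M)); last by lra.
  exact: ler_pM.
- have -> : phi y * chi y - phi z * chi z =
    phi y * (chi y - chi z) + chi z * (phi y - phi z) by ring.
  apply: le_trans (ler_normD _ _) _; rewrite !normrM.
  have h1 : `|phi y| * `|chi y - chi z| <= L * (M * `|y - z|) by exact: ler_pM.
  have h2 : `|chi z| * `|phi y - phi z| <= M * (L * `|y - z|) by exact: ler_pM.
  by move: h1 h2; move: `|y - z| => t; lra.
- exists (fun y => phi y * dchi y + chi y * dphi y) => y y0.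
  have [d1 c1] := hphi y y0; have [d2 c2] := hchi y y0; split.
    exact: is_deriveM.
  apply: continuousD; apply: continuousM => //.
    exact: C1_pos_continuous hphi y0.
  exact: C1_pos_continuous hchi y0.
Qed.

Lemma tameX phi n : tame phi -> tame (fun y => phi y ^+ n).
Proof.
move=> h; elim: n => [|n IHn]; first exact: tame_cst.
by under eq_fun do rewrite exprS; exact: tameM.
Qed.

Lemma tame_prod I (s : seq I) (phi : I -> R -> R) : (forall i, tame (phi i)) ->
  tame (fun y => \prod_(i <- s) phi i y).
Proof.
move=> h; elim: s => [|i s IHs].
  by under eq_fun do rewrite big_nil; exact: tame_cst.
by under eq_fun do rewrite big_cons; exact: tameM.
Qed.

Lemma tame_sum I (s : seq I) (phi : I -> R -> R) : (forall i, tame (phi i)) ->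
  tame (fun y => \sum_(i <- s) phi i y).
Proof.
move=> h; elim: s => [|i s IHs].
  by under eq_fun do rewrite big_nil; exact: tame_cst.
by under eq_fun do rewrite big_cons; exact: tameD.
Qed.

Definition flat (r y : R) : R := if 0 < y then expR (- expR (r / y)) else 0.

Lemma flat0 r : flat r 0 = 0. Proof. by rewrite /flat ltxx. Qed.

Lemma flatE r y : 0 < y -> flat r y = expR (- expR (r / y)).
Proof. by rewrite /flat => ->. Qed.

Lemma flat_ge0 r y : 0 <= flat r y.
Proof. by rewrite /flat; case: ifP => // _; exact: expR_ge0. Qed.

Definition dflat (r y : R) : R :=
  expR (- expR (r / y)) * (expR (r / y) * (r * y ^- 2)).

Lemma C1_pos_flat r : C1_pos (flat r) (dflat r).
Proof.
move=> y y0; have yN0 : y != 0 by rewrite gt_eqF.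
have ci : {for y, continuous (fun z : R => z^-1)} by exact: inv_continuous.
have cry : {for y, continuous (fun z : R => r / z)}.
  by apply: continuousM => //; exact: cst_continuous.
have ce : {for y, continuous (fun z : R => expR (r / z))}.
  by apply: continuous_comp => //; exact: continuous_expR.
have c1 : {for y, continuous (fun z : R => expR (- expR (r / z)))}.
  apply: (@continuous_comp R R R (fun z => - expR (r / z)) expR y).
    exact: continuousN.
  exact: continuous_expR.
have c2 : {for y, continuous (fun z : R => z ^- 2)}.
  apply: (@continuous_comp R R R (fun z : R => z ^+ 2) (fun z => z^-1) y).
    exact: exprn_continuous.
  by apply: inv_continuous; rewrite expf_neq0.
split; last first.
  apply: continuousM => //; apply: continuousM => //; apply: continuousM => //.
  exact: cst_continuous.
apply: (@near_eq_is_derive R R R (fun z => expR (- expR (r / z))) (flat r)).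
  near=> z; rewrite flatE//; near: z; exact: lt_nbhsr.
have d1 : is_derive y 1 (fun z : R => r / z) (- (r * y ^- 2)).
  have := @is_deriveV R id y 1 1 yN0 (is_derive_id y 1).
  move=> /(is_deriveZ r); rewrite /GRing.scale /= mulr1 mulrN.
  exact.
have d2 := is_derive1_comp (is_derive_expR _) d1.
have d3 := is_derive1_comp (is_derive_expR _) (is_deriveN d2).
by apply: is_derive_eq d3 _; rewrite /dflat /=; ring.
Unshelve. all: by end_near.
Qed.

Lemma expRN_le_inv (x : R) : 0 < x -> expR (- x) <= x^-1.
Proof.
move=> x0; rewrite expRN lef_pV2 ?posrE ?expR_gt0//.
by apply: le_trans (expR_ge1Dx x); rewrite lerDr.
Qed.

(** With [u = r / y] and [w = expR u], the derivative is [expR (- w) * (w * u ^ 2) / r]; then use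
    [u <= w] and [w ^ 3 / 6 <= expR w]. *)
Lemma dflat_le r y : 0 < r -> 0 < y -> `|dflat r y| <= 6 / r.
Proof.
move=> r0 y0; set u := r / y; have u0 : 0 < u by rewrite divr_gt0.
set w := expR u; have w0 : 0 < w by exact: expR_gt0.
have uw : u <= w by apply: le_trans (expR_ge1Dx u); rewrite lerDr.
have -> : dflat r y = expR (- w) * (w * u ^+ 2) / r.
  by rewrite /dflat /w /u; field; rewrite !gt_eqF.
rewrite ger0_norm; last first.
  by rewrite divr_ge0 ?(ltW r0)// mulr_ge0 ?expR_ge0// mulr_ge0 ?sqr_ge0 ?ltW.
rewrite ler_pM2r ?invr_gt0// expRN ler_pdivrMl ?expR_gt0//.
have h := expR_ge1Dxn 2 (ltW w0).
have u2 : u ^+ 2 <= w ^+ 2 by apply: lerXn2r => //; rewrite nnegrE ltW.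
have h2 : w * u ^+ 2 <= w ^+ 3 by rewrite exprS ler_pM2l.
apply: (le_trans h2).
have {}h : 1 + w ^+ 3 / 6 <= expR w by [].
by move: h; move: (w ^+ 3) (expR w) => v e; lra.
Qed.

Lemma tame_flat r : 0 < r -> tame (flat r).
Proof.
move=> r0; have r0' : 0 < r^-1 by rewrite invr_gt0.
(* The summand 1 bounds the values, [6 / r] the derivative. *)
exists (6 / r + 1); split=> [|y|y z|]; first by rewrite addr_gt0// divr_gt0.
- rewrite ger0_norm ?flat_ge0//; apply: (@le_trans _ _ 1); last first.
    by rewrite lerDr divr_ge0// ltW.
  by rewrite /flat; case: ifP => // _; rewrite -expR0 ler_expR oppr_le0 expR_ge0.
- wlog yz : y z / y < z.
    move=> h; have [yz|yz|->] := ltgtP y z; first exact: h.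
      by rewrite distrC [`|y - z|]distrC; exact: h.
    by rewrite !subrr normr0 mulr0.
  rewrite distrC [`|y - z|]distrC (gtr0_norm (x := z - y)) ?subr_gt0//.
  have [y0|y0] := ltP 0 y.
    have [c cyz ->] : exists2 c, c \in `]y, z[ &
        flat r z - flat r y = dflat r c * (z - y).
      apply: MVT => // [c|].
        rewrite in_itv /= => /andP[yc _].
        exact: (C1_pos_flat r (lt_trans y0 yc)).1.
      apply: continuous_in_subspaceT => c; rewrite inE /= in_itv /= => /andP[yc _].
      exact: C1_pos_continuous (@C1_pos_flat r) (lt_le_trans y0 yc).
    move: cyz; rewrite in_itv /= => /andP[yc _].
    rewrite normrM (gtr0_norm (x := z - y)) ?subr_gt0// ler_wpM2r ?subr_ge0 ?(ltW yz)//.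
    by apply: le_trans (dflat_le r0 (lt_trans y0 yc)) _; rewrite lerDl.
  (* Here [y <= 0], and for [0 < z] the decay at 0 gives [flat r z <= z / r <= (z - y) / r]. *)
  rewrite /flat (ltNge 0 y) y0 /= subr0; case: ifPn => [z0|_]; last first.
    by rewrite normr0 mulr_ge0 ?subr_ge0 ?(ltW yz)// addr_ge0// divr_ge0// ltW.
  rewrite ger0_norm ?expR_ge0//.
  have u0 : 0 < r / z by rewrite divr_gt0.
  apply: le_trans (expRN_le_inv (expR_gt0 _)) _.
  apply: (@le_trans _ _ (r / z)^-1).
    rewrite lef_pV2 ?posrE ?expR_gt0//.
    by apply: le_trans (expR_ge1Dx (r / z)); rewrite lerDr.
  rewrite invf_div mulrC; apply: (@le_trans _ _ (r^-1 * (z - y))).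
    by rewrite ler_pM2l// lerBrDl gerDr.
  by rewrite ler_wpM2r ?subr_ge0 ?(ltW yz)//; lra.
- by exists (dflat r); exact: C1_pos_flat.
Qed.

(** The mean value theorem gives a point [y0] with nonzero derivative. Near it the derivative keeps
    at least half its size, and the mean value theorem applies again. As [y0 < y1], it will be a
    value of the zigzag whenever [y1] is. *)
Lemma tame_locally_expanding phi (y1 : R) : tame phi -> phi 0 = 0 -> 0 < y1 ->
  phi y1 != 0 -> exists y0 eta c, [/\ 0 < y0 < y1, 0 < eta, 0 < c &
    forall u v, `|u - y0| < eta -> `|v - y0| < eta ->
      c * `|u - v| <= `|phi u - phi v|].
Proof.
move=> [L [L0 _ phiL [dphi hphi]]] phi0 y10 phiy1.
have phic := lipschitz_continuous phiL.
have [y0 y0in] : exists2 c, c \in `]0, y1[ & phi y1 - phi 0 = dphi c * (y1 - 0).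
  apply: MVT => // [c|]; last by apply: continuous_subspaceT.
  by rewrite in_itv /= => /andP[c0 _]; exact: (hphi c c0).1.
rewrite phi0 !subr0 => E; move: y0in; rewrite in_itv /= => /andP[y00 y01].
have dN0 : dphi y0 != 0.
  by apply: contra_neq phiy1 => d0; rewrite E d0 mul0r.
have dn0 : 0 < `|dphi y0| by rewrite normr_gt0.
have d2 : 0 < `|dphi y0| / 2 by rewrite divr_gt0.
have /cvgrPdist_lt/(_ _ d2)/nbhs_ballP[/= eta eta0 near_y0] := (hphi y0 y00).2.
(* A radius of at most [y0] keeps [u] and [v] positive. *)
exists y0, (Num.min eta y0), (`|dphi y0| / 2); split=> //.
- by rewrite y00.
- by rewrite lt_min eta0.
move=> u v; rewrite !lt_min => /andP[u1 u2] /andP[v1 v2].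
wlog uv : u v u1 u2 v1 v2 / u < v.
  move=> h; have [uv|uv|->] := ltgtP u v; first exact: h.
    by rewrite distrC [leRHS]distrC; exact: h.
  by rewrite !subrr normr0 mulr0.
have u0 : 0 < u by move: u2; rewrite ltr_norml; lra.
have [c cuv Ec] : exists2 c, c \in `]u, v[ & phi v - phi u = dphi c * (v - u).
  apply: MVT => // [c|]; last by apply: continuous_subspaceT.
  rewrite in_itv /= => /andP[uc _]; exact: (hphi c (lt_trans u0 uc)).1.
move: cuv; rewrite in_itv /= => /andP[uc cv].
rewrite distrC [leRHS]distrC Ec normrM ler_wpM2r//.
have : `|dphi y0 - dphi c| < `|dphi y0| / 2.
  apply: near_y0; rewrite /ball /= distrC.
  by move: u1 v1; rewrite !ltr_norml => /andP[? ?] /andP[? ?]; apply/andP; split; lra.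
move=> h; have := lerB_dist (dphi y0) (dphi c); lra.
Qed.

End tame_functions.

(** * Algebraic independence of the flat functions *)

Section independence.
Variable R : realType.

Lemma eventually_all (I : eqType) (s : seq I) (Q : I -> R -> Prop) :
  (forall i, i \in s -> exists T, forall t, T <= t -> Q i t) ->
  exists T, forall t, T <= t -> forall i, i \in s -> Q i t.
Proof.
elim: s => [|i s IHs] h; first by exists 0.
have [T1 h1] := h i (mem_head _ _).
have [j js|T2 h2] := IHs; first by apply: h; rewrite inE js orbT.
exists (Num.max T1 T2) => t; rewrite ge_max => /andP[t1 t2] j.
by rewrite inE => /orP[/eqP ->|js]; [exact: h1|exact: h2].
Qed.

Lemma seq_argmin (I : eqType) (s : seq I) (g : I -> R) : s != [::] ->
  exists2 i, i \in s & forall j, j \in s -> g i <= g j.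
Proof.
elim: s => // i [|k s] IHs _.
  by exists i => [|j]; rewrite !inE// => /eqP ->.
have [//|j js jmin] := IHs; have [ij|ji] := leP (g i) (g j).
  exists i => [|l]; rewrite inE ?eqxx// => /orP[/eqP -> //|ls].
  exact: le_trans ij (jmin l ls).
exists j => [|l]; first by rewrite inE js orbT.
by rewrite inE => /orP[/eqP ->|/jmin //]; exact: ltW.
Qed.

(** The largest [r i] with [k i] nonzero dominates: relative to its exponential, that of any other
    such [j] is at most [1 / ((r i - r j) * t)]. *)
Lemma exp_sum_unbounded n (r k : 'I_n -> R) (A : R) : injective r ->
  (forall i, 0 < r i) -> (exists i, k i != 0) ->
  exists T, forall t, T <= t -> A <= `|\sum_i k i * expR (r i * t)|.
Proof.
move=> r_inj r0 [i0 ki0].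
case: (@arg_maxP _ _ _ i0 (fun i => k i != 0) r ki0) => i /= ki imax.
have kn0 : 0 < `|k i| by rewrite normr_gt0.
pose K := \sum_(j | (j != i) && (k j != 0)) `|k j| / (r i - r j).
have rij j : j != i -> k j != 0 -> 0 < r i - r j.
  move=> ji kj; rewrite subr_gt0 lt_neqAle imax// andbT.
  by apply: contra_neq ji; exact: r_inj.
have K0 : 0 <= K.
  by apply: sumr_ge0 => j /andP[ji kj]; rewrite divr_ge0// ltW// rij.
(* The first summand makes [t] positive, the second leaves at least half of the leading term after
   the others, the third makes this half at least [|A|]. *)
exists (1 + 2 * K / `|k i| + 2 * `|A| / (r i * `|k i|)) => t tT.
have a0 : 0 <= 2 * K / `|k i| by rewrite divr_ge0// mulr_ge0.
have b0 : 0 <= 2 * `|A| / (r i * `|k i|).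
  by rewrite divr_ge0// mulr_ge0// ltW.
have t0 : 0 < t by lra.
have tK : K / t <= `|k i| / 2.
  rewrite ler_pdivrMr// mulrAC ler_pdivlMr// mulrC -ler_pdivrMl// mulrC; lra.
have tA : `|A| <= r i * t * (`|k i| / 2).
  have : 2 * `|A| / (r i * `|k i|) <= t by lra.
  by rewrite ler_pdivrMr ?mulr_gt0//; lra.
have rest : `|\sum_(j | j != i) k j * expR (r j * t)| <=
    expR (r i * t) * (K / t).
  rewrite (bigID (fun j => k j == 0)) /= [X in X + _]big1 ?add0r; last first.
    by move=> j /andP[_ /eqP ->]; rewrite mul0r.
  apply: le_trans (ler_norm_sum _ _ _) _.
  rewrite /K mulr_suml mulr_sumr; apply: ler_sum => j /andP[ji kj].
  have rj := rij j ji kj.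
  rewrite normrM (ger0_norm (expR_ge0 _)).
  have -> : r j * t = r i * t + - ((r i - r j) * t) by ring.
  rewrite expRD mulrCA ler_pM2l ?expR_gt0//.
  rewrite -mulrA ler_wpM2l// -invfM; apply: expRN_le_inv.
  exact: mulr_gt0.
rewrite (bigD1 i)//=; set S := \sum_(j | _) _ in rest *.
have h1 := lerB_normD (k i * expR (r i * t)) S.
apply: le_trans h1; rewrite normrM (gtr0_norm (expR_gt0 _)).
apply: le_trans (ler_norm A) _; apply: (le_trans tA).
have e0 := expR_gt0 (r i * t); have e1 := expR_ge1Dx (r i * t).
have h2 : expR (r i * t) * (K / t) <= expR (r i * t) * (`|k i| / 2).
  by rewrite ler_pM2l.
have h3 : r i * t * (`|k i| / 2) <= expR (r i * t) * (`|k i| / 2).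
  by rewrite ler_pM2r ?divr_gt0//; lra.
by move: h3 h2 rest; move: (expR _) => e; lra.
Qed.

(* At a time when all exponents are far apart, the smallest one dominates. *)
Lemma exp_comb_neq0 (I : eqType) (s : seq I) (c : I -> R) (E : I -> R -> R) :
  uniq s -> s != [::] -> (forall i, i \in s -> c i != 0) ->
  (forall i j, i \in s -> j \in s -> i != j -> forall A, exists T,
     forall t, T <= t -> A <= `|E i t - E j t|) ->
  exists2 t, 1 <= t & \sum_(i <- s) c i * expR (- E i t) != 0.
Proof.
move=> us sN0 cN0 sep.
pose C := \sum_(i <- s) `|c i|; have C0 : 0 <= C by exact: sumr_ge0.
pose V := \sum_(i <- s) `|c i|^-1.
have V0 : 0 <= V by apply: sumr_ge0 => i _; rewrite invr_ge0.
(* The gap is fixed before [t], whereas the index [i] of the smallest exponent depends on [t]; hence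
   [V], which bounds [1 / |c i|] for all [i]. Then [|c i| * A > C], so the other terms cannot cancel
   that of [i]. *)
pose A := 1 + C * V; have A0 : 0 < A by rewrite ltr_wpDr// mulr_ge0.
have [T hT] : exists T, forall t, T <= t -> forall ij, ij \in [seq (i, j) | i <- s, j <- s] ->
    ij.1 != ij.2 -> A <= `|E ij.1 t - E ij.2 t|.
  apply: eventually_all => -[i j] /allpairsP[[i' j'] [/= si sj [-> ->]]].
  have [->|ij] := eqVneq i' j'; first by exists 0.
  by have [T hT] := sep _ _ si sj ij A; exists T => t /hT.
pose t := Num.max 1 T; exists t; first by rewrite le_max lexx.
have tT : T <= t by rewrite le_max lexx orbT.
have [i si imin] := seq_argmin (E^~ t) sN0.
have ci : 0 < `|c i| by rewrite normr_gt0 cN0.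
rewrite (bigD1_seq i)//=; set S := \sum_(j <- s | _) _.
suff : `|S| < `|c i| * expR (- E i t).
  move=> Slt; apply/eqP => /(canRL (addrK _)); rewrite add0r => ES.
  move: Slt; rewrite -[`|S|]normrN -ES normrM (gtr0_norm (expR_gt0 _)).
  by rewrite ltxx.
have SC : `|S| <= C * (expR (- E i t) * A^-1).
  apply: (@le_trans _ _ (\sum_(j <- s | j != i) `|c j| * (expR (- E i t) * A^-1))).
    apply: le_trans (ler_norm_sum _ _ _) _.
    rewrite big_seq_cond [leRHS]big_seq_cond; apply: ler_sum => j /andP[sj ji].
    rewrite normrM (gtr0_norm (expR_gt0 _)) ler_wpM2l//.
    have := hT t tT (j, i) (allpairs_f pair sj si) ji => /=.
    rewrite ger0_norm ?subr_ge0 ?imin// => AE.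
    apply: (@le_trans _ _ (expR (- E i t + - A))).
      by rewrite ler_expR; lra.
    by rewrite expRD ler_pM2l ?expR_gt0// expRN_le_inv.
  rewrite -mulr_suml ler_wpM2r ?mulr_ge0 ?expR_ge0 ?invr_ge0 ?(ltW A0)//.
  by rewrite /C [leRHS](bigD1_seq i)//= lerDr.
apply: (le_lt_trans SC); rewrite mulrCA mulrC ltr_pM2r ?expR_gt0//.
rewrite ltr_pdivrMr//.
have iV : `|c i|^-1 <= V.
  by rewrite /V (bigD1_seq i)//= lerDl sumr_ge0// => j _; rewrite invr_ge0.
have : `|c i| * (C * `|c i|^-1) <= `|c i| * (C * V) by rewrite !ler_wpM2l.
by rewrite mulrCA mulfV ?gt_eqF// mulr1 /A mulrDr mulr1; lra.
Qed.

Lemma flat_monomial n (r : 'I_n -> R) (m : 'I_n -> nat) (t : R) : 0 < t ->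
  \prod_i flat (r i) t^-1 ^+ m i =
  expR (- \sum_i (m i)%:R * expR (r i * t)).
Proof.
move=> t0; rewrite -sumrN expR_sum; apply: eq_bigr => i _.
by rewrite flatE ?invr_gt0// invrK -expRM_natl mulrN.
Qed.

(** At [y = 1 / t] the monomial [m] equals [expR (- E)] with [E] the sum of the
    [m i * expR (r i * t)]. Two distinct monomials have exponents whose difference is unbounded by
    [exp_sum_unbounded]. The bound [y <= 1] makes [y] a value of the zigzag. *)
Lemma flat_independent n (r : 'I_n -> R) (P : mpoly.mpoly n R) : injective r ->
  (forall i, 0 < r i) -> P != 0 -> exists2 y, 0 < y <= 1 &
  \sum_(m <- mpoly.msupp P) mpoly.mcoeff m P * \prod_i flat (r i) y ^+ m i != 0.
Proof.
move=> r_inj r0 P0.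
have [||m|m m' _ _ mm' A|t t1] := @exp_comb_neq0 _ (mpoly.msupp P)
  (fun m => mpoly.mcoeff m P)
  (fun (m : mpoly.multinom n) t => \sum_i (m i)%:R * expR (r i * t)).
- exact: mpoly.msupp_uniq.
- by rewrite mpoly.msupp_eq0.
- by rewrite mpoly.mcoeff_msupp.
- have [i mi] : exists i, m i != m' i.
    apply/existsP; apply: contra_neqT mm' => /existsPn h; apply/mpoly.mnmP => i.
    by apply/eqP; move: (h i); rewrite negbK.
  have [|T hT] := exp_sum_unbounded (k := fun i => (m i)%:R - (m' i)%:R) A r_inj r0.
    by exists i; rewrite subr_eq0 eqr_nat.
  exists T => t tT; rewrite -sumrB; under eq_bigr do rewrite -mulrBl; exact: hT.
- have t0 : 0 < t by exact: lt_le_trans t1.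
  move=> h; exists t^-1; first by rewrite invr_gt0 t0 invf_le1.
  by under eq_bigr do rewrite flat_monomial//.
Qed.

End independence.

Section zigzag_continuity.
Variable R : realType.
Variables p q : nat -> nat.
Hypothesis p_odd : forall n, odd (p n).
Hypothesis q_gt1 : forall n, (1 < q n)%N.
Let q_gt0 n : (0 < q n)%N := ltnW (q_gt1 n).
Notation f := (zigzag p q : R -> R).

Lemma zigzag_uniform (eta : R) : 0 < eta -> exists2 e : R, 0 < e &
  forall x y, `|x - y| <= e -> `|f x - f y| < eta.
Proof.
move=> eta0; pose n := Num.truncn (2 / eta).
have c0 : 0 < (cells p q n.+1)%:R :> R by rewrite ltr0n (cells_gt0 p_odd q_gt0).
exists (cells p q n.+1)%:R^-1; first by rewrite invr_gt0.
move=> x y /(zigzag_close p_odd q_gt0)/le_lt_trans; apply.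
rewrite ltr_pdivrMr ?ltr0n ?(strips_gt0 q_gt0)// -ltr_pdivrMl// mulrC.
apply: lt_le_trans (truncnS_gt _) _; rewrite ler_nat.
exact: ltnW (ltn_strips q_gt1 _).
Qed.

Lemma zigzag_continuous : continuous f.
Proof.
move=> x; apply/cvgrPdist_lt => /= eps eps0.
have [e e0 he] := zigzag_uniform eps0; near=> y; apply: he; near: y.
exact: (@cvgr_dist_le _ _ _ _ _ id x).
Unshelve. all: by end_near.
Qed.

End zigzag_continuity.

Section mpoly_evaluation.
Variable R : realType.

Lemma C01_sumE I (s : seq I) (F : I -> C01 R) z :
  (\sum_(i <- s) F i : C01 R) z = \sum_(i <- s) F i z.
Proof. by elim: s => [|i s IHs]; rewrite ?big_nil// !big_cons -IHs. Qed.

Lemma C01_prodE I (s : seq I) (F : I -> C01 R) z :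
  (\prod_(i <- s) F i : C01 R) z = \prod_(i <- s) F i z.
Proof. by elim: s => [|i s IHs]; rewrite ?big_nil// !big_cons -IHs. Qed.

Lemma C01_expE (a : C01 R) n z : (a ^+ n : C01 R) z = a z ^+ n.
Proof. by elim: n => // n IHn; rewrite !exprS -IHn. Qed.

Lemma mpoly_evalE n (x : 'I_n -> C01 R) (P : mpoly.mpoly n R) z :
  mpoly_eval x P z =
  \sum_(m <- mpoly.msupp P) mpoly.mcoeff m P * \prod_i x i z ^+ m i.
Proof.
rewrite /mpoly_eval /mpoly.mmap C01_sumE; apply: eq_bigr => m _.
rewrite [LHS](_ : _ = in_alg (C01 R) (mpoly.mcoeff m P) z * mpoly.mmap1 x m z)//.
congr (_ * _); first exact: mulr1.
by rewrite /mpoly.mmap1 C01_prodE; apply: eq_bigr => i _; rewrite C01_expE.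
Qed.

End mpoly_evaluation.

(** * The free generators and the dimensions of polynomials in them *)

Section generators.
Variable R : realType.
Variable th : R.
Hypothesis th01 : 0 < th <= 1.

Notation p := (lap_ratio th).
Notation q := (strip_ratio th).
Notation f := (zigzag p q : R -> R).

Let p_odd := lap_ratio_odd th.
Let q_gt1 := strip_ratio_gt1 th01.
Let q_gt0 n := ltnW (q_gt1 n).

Lemma tame_continuous (phi : R -> R) : tame phi -> continuous phi.
Proof. by case=> L [_ _ /lipschitz_continuous]. Qed.

Lemma tame_zigzag_continuous (phi : R -> R) : tame phi ->
  continuous (fun z : unit_interval R => phi (f (val z))).
Proof.
move=> /tame_continuous phic z.
apply: (@continuous_comp _ _ _ (val : unit_interval R -> R) (phi \o f)).
  exact: initial_continuous.
apply: (@continuous_comp R R R f phi).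
  exact: (zigzag_continuous p_odd q_gt1).
exact: phic.
Qed.

Lemma tame_flat_expR (u : R) : tame (flat (expR u)).
Proof. by apply: tame_flat; exact: expR_gt0. Qed.

(** Taking [r = expR u] indexes the generators by the whole real line, which gives their
    cardinality. *)
Definition generator (u : R) : C01 R :=
  C01_mk (tame_zigzag_continuous (tame_flat_expR u)).

(** Where [a] is nonzero [f] is positive, and below that value of [f] lies a [y0] near which [phi]
    is expanding. The zigzag takes the value [y0] at some [x0 < x1], and by uniform continuity stays
    near [y0] on a short interval to the right of [x0]; there [dims_graph] applies. *)
Lemma dims_tame_zigzag (phi : R -> R) (a : C01 R) : tame phi -> phi 0 = 0 ->
  (forall z, a z = phi (f (val z))) -> a <> 0 ->
  hausdorff_dim (graph a) = (1 + th)%:E /\ has_box_dim (graph a) (1 + th).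
Proof.
move=> tphi phi0 aphi aN0.
have [z az] : exists z, a z != 0.
  apply: contrapT => /forallNP h; apply: aN0; apply: C01P => z.
  by apply/eqP/negPn/negP; exact: h.
have := valP z; rewrite inE /= in_itv /=; set x1 := val z => /andP[x10 x11].
have f1N0 : phi (f x1) != 0 by rewrite -aphi.
have f10 : 0 < f x1.
  rewrite lt_neqAle (zigzag_ge0 p_odd q_gt0) andbT.
  by apply: contra_neq f1N0 => <-.
have [y0 [eta [c [/andP[y00 y01] eta0 c0 hexp]]]] :=
  tame_locally_expanding tphi phi0 f10 f1N0.
have fc : continuous f by exact: (zigzag_continuous p_odd q_gt1).
have [x0 x0in fx0] : exists2 x0, x0 \in `[0, x1] & f x0 = y0.
  apply: IVT => //; first exact: (continuous_subspaceT fc).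
  rewrite (zigzag0 _ p_odd q_gt0) ge_min le_max.
  by rewrite (ltW y00) (ltW y01) orbT.
move: x0in; rewrite in_itv /= => /andP[x00 x01].
have x0lt : x0 < x1.
  rewrite lt_neqAle x01 andbT; apply: contraTneq y01 => <-.
  by rewrite fx0 ltxx.
have [e e0 he] := zigzag_uniform p_odd q_gt1 eta0.
have [L [L0 _ phiL _]] := tphi.
apply: (dims_graph th01 (F := phi \o f) (L := L) (c := c)
  (al := x0) (be := Num.min x1 (x0 + e))) => //.
- by move=> x y; exact: phiL.
- by rewrite lt_min x0lt ltrDl.
- by rewrite ge_min x11.
move=> x y /andP[x0x]; rewrite !le_min => /andP[_ xe].
move=> /andP[x0y] /andP[_ ye]; apply: hexp; rewrite -fx0; apply: he.
  by rewrite ger0_norm ?subr_ge0// lerBlDl.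
by rewrite ger0_norm ?subr_ge0// lerBlDl.
Qed.

Lemma generator_inj : injective generator.
Proof.
move=> u v uv.
have I1 : (1 : R) \in (`[0, 1]%classic : set R).
  by rewrite inE /= in_itv /= lexx ler01.
have : flat (expR u) (f 1) = flat (expR v) (f 1).
  exact: (congr1 (fun a : C01 R => a (exist _ 1 I1)) uv).
rewrite (zigzag1 R p_odd q_gt0).
rewrite !(flatE _ ltr01).
rewrite !divr1.
by move=> /expR_inj /oppr_inj /expR_inj /expR_inj.
Qed.

Definition poly_flat n (u : 'I_n -> R) (P : mpoly.mpoly n R) (y : R) :=
  \sum_(m <- mpoly.msupp P)
    mpoly.mcoeff m P * \prod_i flat (expR (u i)) y ^+ m i.

Lemma tame_poly_flat n (u : 'I_n -> R) (P : mpoly.mpoly n R) :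
  tame (poly_flat u P).
Proof.
apply: tame_sum => m; apply: tameM; first exact: tame_cst.
by apply: tame_prod => i; apply: tameX; exact: tame_flat_expR.
Qed.

(** Every monomial of [P] contains a variable, and each [flat] vanishes at 0. *)
Lemma poly_flat0 n (u : 'I_n -> R) (P : mpoly.mpoly n R) :
  no_constant_term P -> poly_flat u P 0 = 0.
Proof.
move=> P0; apply: big1 => m _.
have [->|mN0] := eqVneq m mpoly.mnm0; first by rewrite P0 mul0r.
have [i mi] : exists i, m i != 0%N.
  apply/existsP; apply: contra_neqT mN0 => /existsPn h; apply/mpoly.mnmP => i.
  by rewrite mpoly.mnm0E; apply/eqP; move: (h i); rewrite negbK.
by rewrite (bigD1 i)//= flat0 expr0n (negbTE mi) mul0r mulr0.
Qed.

Lemma mpoly_eval_generator n (u : 'I_n -> R) (P : mpoly.mpoly n R) z :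
  mpoly_eval (fun i => generator (u i)) P z = poly_flat u P (f (val z)).
Proof. exact: mpoly_evalE. Qed.

(** A polynomial in the generators is [poly_flat] composed with [f]. By the intermediate value
    theorem [f] attains every value in [0, 1], in particular the one where [flat_independent] makes
    [poly_flat] nonzero. *)
Lemma generator_free : free_generators (range generator).
Proof.
move=> n x P x_inj xX P0.
have /choice[u ux] : forall i, exists u, generator u = x i.
  by move=> i; have [u _ <-] := xX i; exists u.
have -> : x = fun i => generator (u i) by apply/funext.
have u_inj : injective u.
  by move=> i j uij; apply: x_inj; rewrite -(ux i) -(ux j) uij.
split=> [eval0|->]; last first.
  by rewrite /mpoly_eval mpoly.mmap0.
apply: contrapT => /eqP PN0.
have [||y1 /andP[y10 y11]] := @flat_independent R n (fun i => expR (u i)) P _ _ PN0.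
- by move=> i j /expR_inj/u_inj.
- by move=> i; exact: expR_gt0.
have fc : continuous f by exact: (zigzag_continuous p_odd q_gt1).
have [x1 x1in fx1] : exists2 x1, x1 \in `[0, 1] & f x1 = y1.
  apply: IVT => //; first exact: (continuous_subspaceT fc).
  rewrite (zigzag0 _ p_odd q_gt0) (zigzag1 _ p_odd q_gt0).
  by rewrite ge_min le_max (ltW y10) y11 orbT.
have I1 : x1 \in (`[0, 1]%classic : set R) by rewrite inE.
move=> /eqP; apply; rewrite -/(poly_flat u P y1) -fx1.
rewrite -(mpoly_eval_generator u P (exist _ x1 I1)).
by rewrite eval0.
Qed.

End generators.

Theorem corollary3p4 (R : realType) (s : R) (hs : 1 < s <= 2) :
  strongly_algebrable [set: R]
    [set f : C01 R | hausdorff_dim (graph f) = s%:E /\ has_box_dim (graph f) s].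
Proof.
have th01 : 0 < s - 1 <= 1 by case/andP: hs => ? ?; apply/andP; split; lra.
exists (range (generator th01)); split.
- by apply: inj_card_eq => u v _ _; exact: generator_inj.
(* The [x i] may repeat here, so [u] need not be injective and the element may be 0 even for [P]
   nonzero. *)
- move=> a [n [x [P [xX P0 ->]]]].
  have /choice[u ux] : forall i, exists u, generator th01 u = x i.
    by move=> i; have [u _ <-] := xX i; exists u.
  have -> : x = fun i => generator th01 (u i) by apply/funext.
  have [->|aN0] := pselect (mpoly_eval (fun i => generator th01 (u i)) P = 0).
    by right.
  left; have := dims_tame_zigzag th01 (tame_poly_flat u P) (poly_flat0 u P0)
    (mpoly_eval_generator th01 u P) aN0.
  by rewrite [1 + _]addrC subrK.
- exact: generator_free.
Qed.
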